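(* Let $M=\mathbb{D}=\{z\in\mathbb{C}: |z|\le 1\}$ and $g=(1+\kappa|z|^2)^{-2}|dz|^2$ with $-1<\kappa<1$. Parametrise the transport twistor space $Z$ of $(M,g)$ by $(z,\mu)\in\mathbb{D}\times\mathbb{D}$, where $(z,\mu)$ corresponds to the tangent vector $(1+\kappa|z|^2)(\mu\partial_z+\bar\mu\partial_{\bar z})\in T_z\mathbb{D}$. Then the map $$\beta_\kappa(z,\mu)=\left(\frac{z-\mu^2\bar z}{1+\kappa\bar z^2\mu^2},\ \mu\,\frac{1+\kappa|z|^2}{1+\kappa\bar z^2\mu^2}\right),\qquad (z,\mu)\in\mathbb{D}\times\mathbb{D},$$ has a holomorphic blow-down structure.
   Context: Transport twistor space. For an oriented Riemannian surface $(M,g)$ (possibly with boundary) let $SM$ be the unit tangent bundle and $Z=\{(x,v)\in TM: g(v,v)\le1\}$. $Z$ carries a rank 2 complex subbundle $\mathscr D\subset TZ\otimes\mathbb{C}$: in an oriented isothermal coordinate $z$ with $g=e^{2\sigma}|dz|^2$, parametrise $Z$ by $(z,\mu)$, $|\mu|\le1$, via $(z,\mu)\mapsto(z,e^{-\sigma(z)}(\mu\partial_z+\bar\mu\partial_{\bar z}))$; then $\mathscr D=\mathrm{span}_{\mathbb{C}}(\Xi_\sigma,\partial_{\bar\mu})$ with $$\Xi_\sigma=e^{-\sigma}\bigl(\mu^2\partial_z+\partial_{\bar z}+(\mu^2\partial_z\sigma-\partial_{\bar z}\sigma)(\bar\mu\partial_{\bar\mu}-\mu\partial_\mu)\bigr).$$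 On the interior $Z^\circ=\{(x,v): x\in M^\circ, |v|_g<1\}$, $\mathscr D$ is the $(0,1)$-tangent bundle of a complex structure. Hermitian metric. On $Z^\circ$ define $\underline{\Omega}=i\,\eta_1\wedge\bar\eta_1+i\,\eta_2\wedge\bar\eta_2$, where in the coordinates $(z,\mu)$ on $Z$ given by $(z,\mu)\mapsto(z,e^{-\sigma(z)}(\mu\partial_z+\bar\mu\partial_{\bar z}))$, with $z$ an oriented isothermal coordinate such that $g=e^{2\sigma}|dz|^2$, the $1$-forms $\eta_1=e^{\sigma}(dz-\mu^2d\bar z)$ and $\eta_2=d\mu+\mu(\partial_z\sigma\,dz-\partial_{\bar z}\sigma\,d\bar z)$ form a frame of $\Lambda^{1,0}Z^\circ$. On $\mathbb{C}^2$ with coordinates $(w,\xi)$ put $\Omega_{\mathbb{C}^2}=i\,dw\wedge d\bar w+i\,d\xi\wedge d\bar\xi$. For real $(1,1)$-forms written as $i\sum H_{jk}\eta_j\wedge\bar\eta_k$, inequalities mean inequalities between the Hermitian matrices $H$. $C^\infty_\alpha$-embeddings. Let $(M,g)$ be compact, non-trapping (geodesics reach $\partial M$ in finite time), with strictly convex boundary, and $\nu$ the inward unit normal; $\partial_\pm SM=\{(x,v)\in SM: x\in\partial M, \pm g(v,\nu(x))\ge0\}$. Embed $M$ in the interior of a slightly larger manifold $(\hat M,g)$ which is also non-trapping with strictly convex boundary, with geodesic flow $\hat\varphi_t$ and forward exit time $\hat\tau$. The map $F_g:\partial SM\to\partial S\hat M$, $F_g(x,v)=\hat\varphi_{-\hat\tau(x,-v)}(x,v)$,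 restricts to a homeomorphism from $\partial_+SM$ onto a smooth submanifold with boundary of $\partial S\hat M$; transferring the smooth structure of this image to $\partial_+SM$ defines the $C^\infty_\alpha$-structure. A map $f:\partial_+SM\to\mathbb{R}^m$ is a $C^\infty_\alpha$-embedding if it is an injective immersion that is smooth for the $C^\infty_\alpha$-structure. An embedding $f:S\to\mathbb{C}^2$ of a surface is totally real if $df_x(T_xS)\cap J\,df_x(T_xS)=0$ for all $x\in S$, $J$ being the complex structure of $\mathbb{C}^2$. Holomorphic blow-down structure. A map $\beta\in C^\infty(Z,\mathbb{C}^2)$ has a holomorphic blow-down structure if: (i) $\beta|_{\partial_+SM}:\partial_+SM\to\mathbb{C}^2$ is a totally real $C^\infty_\alpha$-embedding; (ii) $\beta|_{Z^\circ}$ is a biholomorphism onto its image; (iii) $\beta^*\Omega_{\mathbb{C}^2}\ge c\,\underline{\Omega}$ on $Z^\circ$ for some constant $c>0$. *)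

(* Defs.v *)
From Stdlib Require Import Reals Lra.
From Coquelicot Require Export Coquelicot.
Open Scope R_scope.

(** C and C^2 as real, not complex, normed spaces. *)
Notation CR := C_R_NormedModule.
Notation CC := (prod_NormedModule R_AbsRing C_R_NormedModule C_R_NormedModule).

(** On an open subset [U] of a finite-dimensional space this is the usual
    notion of a C^k map: a continuous map is C^(k+1) iff all its directional
    derivatives exist and are C^k. *)
Fixpoint Ck_on {V W : NormedModule R_AbsRing} (U : V -> Prop) (k : nat)
    (f : V -> W) : Prop :=
  (forall p, U p -> continuous f p) /\
  match k with
  | O => True
  | S k' =>
      forall v : V, exists g : V -> W,
        (forall p, U p ->
           is_derive (fun t : R => f (plus p (scal t v))) 0 (g p)) /\
        Ck_on U k' g
  end.

Definition smooth_on {V W : NormedModule R_AbsRing} (U : V -> Prop)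
    (f : V -> W) : Prop :=
  forall k : nat, Ck_on U k f.

(** Smoothness on a set that need not be open, such as a manifold with
    boundary or corners: existence of a smooth extension near the set. *)
Definition smooth_near {V W : NormedModule R_AbsRing} (A : V -> Prop)
    (f : V -> W) : Prop :=
  exists (U : V -> Prop) (h : V -> W),
    open U /\ (forall p, A p -> U p) /\ smooth_on U h /\
    (forall p, A p -> h p = f p).

Definition dir_deriv (f : CC -> C) (p v : CC) : C :=
  (Derive (fun t : R => Re (f (plus p (scal t v)))) 0,
   Derive (fun t : R => Im (f (plus p (scal t v)))) 0).

Definition differential (f : CC -> CC) (p v : CC) : CC :=
  (dir_deriv (fun q => fst (f q)) p v, dir_deriv (fun q => snd (f q)) p v).

Definition d1 (f : CC -> C) (p : CC) : C :=
  ((dir_deriv f p (RtoC 1, RtoC 0) - Ci * dir_deriv f p (Ci, RtoC 0)) / 2)%C.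
Definition d1bar (f : CC -> C) (p : CC) : C :=
  ((dir_deriv f p (RtoC 1, RtoC 0) + Ci * dir_deriv f p (Ci, RtoC 0)) / 2)%C.
Definition d2 (f : CC -> C) (p : CC) : C :=
  ((dir_deriv f p (RtoC 0, RtoC 1) - Ci * dir_deriv f p (RtoC 0, Ci)) / 2)%C.
Definition d2bar (f : CC -> C) (p : CC) : C :=
  ((dir_deriv f p (RtoC 0, RtoC 1) + Ci * dir_deriv f p (RtoC 0, Ci)) / 2)%C.

(** A complexified tangent vector, given by its coefficients with respect to
    d/dz1, d/d(conj z1), d/dz2, d/d(conj z2).  The projections are thus the
    covectors dz1, d(conj z1), dz2, d(conj z2). *)
Record CT : Type := mkCT { dz1 : C; dz1bar : C; dz2 : C; dz2bar : C }.

Definition act (V : CT) (f : CC -> C) (p : CC) : C :=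
  (dz1 V * d1 f p + dz1bar V * d1bar f p
   + dz2 V * d2 f p + dz2bar V * d2bar f p)%C.

Definition push (f : CC -> CC) (p : CC) (V : CT) : CT :=
  mkCT (act V (fun q => fst (f q)) p)
       (act V (fun q => Cconj (fst (f q))) p)
       (act V (fun q => snd (f q)) p)
       (act V (fun q => Cconj (snd (f q))) p).

Definition conj_vec (V : CT) : CT :=
  mkCT (Cconj (dz1bar V)) (Cconj (dz1 V)) (Cconj (dz2bar V)) (Cconj (dz2 V)).

Definition form1 : Type := CT -> C.
Definition form2 : Type := CT -> CT -> C.

Definition conj_form (a : form1) : form1 := fun V => Cconj (a (conj_vec V)).

Definition wedge (a b : form1) : form2 :=
  fun U V => (a U * b V - a V * b U)%C.

Inductive idx : Type := I1 | I2.

Definition sum_idx (F : idx -> C) : C := (F I1 + F I2)%C.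

Definition hermitian_form (eta : idx -> form1) (H : idx -> idx -> C) : form2 :=
  fun U V =>
    (Ci * sum_idx (fun j => sum_idx (fun k =>
       H j k * wedge (eta j) (conj_form (eta k)) U V)))%C.

Definition hermitian (H : idx -> idx -> C) : Prop :=
  forall j k, H k j = Cconj (H j k).

Definition herm_le (A B : idx -> idx -> C) : Prop :=
  forall xi : idx -> C,
    0 <= Re (sum_idx (fun j => sum_idx (fun k =>
               (B j k - A j k) * xi j * Cconj (xi k))))%C.

Definition represents (eta : idx -> form1) (w : form2) (H : idx -> idx -> C)
    : Prop :=
  hermitian H /\ forall U V, w U V = hermitian_form eta H U V.

(** Inequality of real (1,1)-forms at a point, with respect to a (1,0)-frame. *)
Definition form_le (eta : idx -> form1) (w w' : form2) : Prop :=
  exists A B, represents eta w A /\ represents eta w' B /\ herm_le A B.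

Definition sum_form (eta : idx -> form1) : form2 :=
  fun U V =>
    (Ci * wedge (eta I1) (conj_form (eta I1)) U V
     + Ci * wedge (eta I2) (conj_form (eta I2)) U V)%C.

Definition Omega_C2 : form2 :=
  sum_form (fun j => match j with I1 => dz1 | I2 => dz2 end).

Definition pullback (f : CC -> CC) (p : CC) (w : form2) : form2 :=
  fun U V => w (push f p U) (push f p V).

(** A complex structure is given by its (0,1)-tangent spaces. *)
Definition T01_C2 (p : CC) (V : CT) : Prop := dz1 V = RtoC 0 /\ dz2 V = RtoC 0.

Definition holomorphic_on (U : CC -> Prop) (D D' : CC -> CT -> Prop)
    (f : CC -> CC) : Prop :=
  smooth_on U f /\ forall p V, U p -> D p V -> D' (f p) (push f p V).

Definition image (U : CC -> Prop) (f : CC -> CC) : CC -> Prop :=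
  fun q => exists p, U p /\ f p = q.

Definition biholomorphic_onto_image (U : CC -> Prop) (D D' : CC -> CT -> Prop)
    (f : CC -> CC) : Prop :=
  open (image U f) /\ holomorphic_on U D D' f /\
  exists g : CC -> CC,
    (forall p, U p -> g (f p) = p) /\ holomorphic_on (image U f) D' D g.

(** The metric is e^(2 sigma) |dz|^2, on a disc |z| <= r; a tangent vector
    v d/dz + conj(v) d/d(conj z) at x is the pair (x, v). *)
Definition metric (sigma : CR -> R) (x v w : C) : R :=
  exp (2 * sigma x) * Re (v * Cconj w)%C.

Definition dz (sigma : CR -> R) (x : C) : C :=
  (Derive (fun t : R => sigma (x + RtoC t)%C) 0 / 2,
   - (Derive (fun t : R => sigma (x + Ci * RtoC t)%C) 0 / 2)).
Definition dzbar (sigma : CR -> R) (x : C) : C := Cconj (dz sigma x).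

Definition chart (sigma : CR -> R) (p : C * C) : C * C :=
  (fst p, (RtoC (exp (- sigma (fst p))) * snd p)%C).

Definition unit_vector (sigma : CR -> R) (v : C * C) : Prop :=
  metric sigma (fst v) (snd v) (snd v) = 1.

(** Inward unit normal of the disc of radius [r] at the boundary point [x]. *)
Definition normal (sigma : CR -> R) (r : R) (x : C) : C :=
  (- (RtoC (exp (- sigma x) / r) * x))%C.

(** The only non-vanishing Christoffel symbols are Gamma^z_zz = 2 d_z sigma
    and its conjugate. *)
Definition covariant_acceleration (sigma : CR -> R) (x v a : C) : C :=
  (a + 2 * dz sigma x * (v * v))%C.

Definition geodesic_on (sigma : CR -> R) (a b : R) (gamma w : R -> CR) : Prop :=
  forall t, a <= t <= b ->
    is_derive gamma t (w t) /\
    exists acc : CR,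
      is_derive w t acc /\
      covariant_acceleration sigma (gamma t) (w t) acc = RtoC 0.

(** The geodesic flow of the disc of radius [r], as a relation: [p] goes to [q]
    in time [t].  Here and below, points of the unit tangent bundle are given
    by their coordinates (z, mu). *)
Definition flow (sigma : CR -> R) (r t : R) (p q : C * C) : Prop :=
  exists gamma w : R -> CR,
    geodesic_on sigma (Rmin 0 t) (Rmax 0 t) gamma w /\
    (gamma 0, w 0) = chart sigma p /\ (gamma t, w t) = chart sigma q /\
    forall s, Rmin 0 t <= s <= Rmax 0 t -> Cmod (gamma s) <= r.

(** [T] is the forward exit time of [p].  The sign condition makes the exit
    time of an inward pointing boundary vector the time of its next boundary
    point rather than 0. *)
Definition exit_time (sigma : CR -> R) (r : R) (p : C * C) (T : R) : Prop :=
  0 <= T /\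
  exists gamma w : R -> CR,
    geodesic_on sigma 0 T gamma w /\
    (gamma 0, w 0) = chart sigma p /\
    (forall t, 0 < t < T -> Cmod (gamma t) < r) /\
    Cmod (gamma T) = r /\
    metric sigma (gamma T) (w T) (normal sigma r (gamma T)) <= 0.

Definition non_trapping (sigma : CR -> R) (r : R) : Prop :=
  forall p : C * C, Cmod (fst p) <= r -> unit_vector sigma (chart sigma p) ->
    exists T, exit_time sigma r p T.

(** Positivity of the second fundamental form with respect to the inward
    normal, evaluated on the boundary curve t |-> x e^(it), whose velocity and
    (Euclidean) acceleration at t = 0 are ix and -x. *)
Definition strictly_convex_boundary (sigma : CR -> R) (r : R) : Prop :=
  forall x : C, Cmod x = r ->
    0 < metric sigma x (covariant_acceleration sigma x (Ci * x)%C (- x)%C)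
                       (normal sigma r x).

Definition enlargement (sigma : CR -> R) (r : R) : Prop :=
  1 < r /\
  (exists U : CR -> Prop,
     open U /\ (forall x : C, Cmod x <= r -> U x) /\
     smooth_on (W := R_NormedModule) U sigma) /\
  non_trapping sigma r /\ strictly_convex_boundary sigma r.

Definition influx_boundary (sigma : CR -> R) (p : CC) : Prop :=
  Cmod (fst p) = 1 /\ unit_vector sigma (chart sigma p) /\
  0 <= metric sigma (fst p) (snd (chart sigma p)) (normal sigma 1 (fst p)).

(** [Fg sigma r p q] is the graph of the map (x, v) |-> phi_(-T)(x, v), where
    T is the exit time of (x, -v), and phi the geodesic flow, both for the
    disc of radius [r]. *)
Definition Fg (sigma : CR -> R) (r : R) (p q : C * C) : Prop :=
  exists T, exit_time sigma r (fst p, (- snd p)%C) T /\ flow sigma r (- T) p q.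

(** In the coordinates (z, mu), the unit tangent bundle of the enlarged disc
    over its boundary is the torus |z| = r, |mu| = 1.  The image of the influx
    boundary has codimension 0 in it, so that this is also the tangent space
    of that image. *)
Definition torus_tangent (q v : CC) : Prop :=
  Re (fst v * Cconj (fst q))%C = 0 /\ Re (snd v * Cconj (snd q))%C = 0.

(** Here [F] is the map of which [Fg] is the graph, and [h] is a smooth
    extension of f o F^(-1) from the image of [F]. *)
Definition totally_real_alpha_embedding_in (sigma : CR -> R) (r : R)
    (f : CC -> CC) : Prop :=
  (forall p p', influx_boundary sigma p -> influx_boundary sigma p' ->
     f p = f p' -> p = p') /\
  exists (F : CC -> CC) (U : CC -> Prop) (h : CC -> CC),
    (forall p, influx_boundary sigma p -> Fg sigma r p (F p)) /\
    open U /\ (forall p, influx_boundary sigma p -> U (F p)) /\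
    smooth_on U h /\
    (forall p, influx_boundary sigma p -> h (F p) = f p) /\
    (forall p v, influx_boundary sigma p -> torus_tangent (F p) v ->
       differential h (F p) v = (RtoC 0, RtoC 0) -> v = (RtoC 0, RtoC 0)) /\
    (forall p v v', influx_boundary sigma p ->
       torus_tangent (F p) v -> torus_tangent (F p) v' ->
       differential h (F p) v
         = ((Ci * fst (differential h (F p) v'))%C,
            (Ci * snd (differential h (F p) v'))%C) ->
       differential h (F p) v = (RtoC 0, RtoC 0)).

(** The structure does not depend on the enlargement; we ask that there is one
    and that the property holds for all of them. *)
Definition totally_real_alpha_embedding (sigma : CR -> R) (f : CC -> CC)
    : Prop :=
  (exists r, enlargement sigma r) /\
  forall r, enlargement sigma r -> totally_real_alpha_embedding_in sigma r f.

Definition Z (p : CC) : Prop := Cmod (fst p) <= 1 /\ Cmod (snd p) <= 1.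
Definition Z_int (p : CC) : Prop := Cmod (fst p) < 1 /\ Cmod (snd p) < 1.

Definition Xi (sigma : CR -> R) (p : CC) : CT :=
  let z := fst p in
  let mu := snd p in
  let e := RtoC (exp (- sigma z)) in
  let m := (mu * mu * dz sigma z - dzbar sigma z)%C in
  mkCT (e * (mu * mu))%C e (- (e * m * mu))%C (e * m * Cconj mu)%C.

Definition d_mubar : CT := mkCT (RtoC 0) (RtoC 0) (RtoC 0) (RtoC 1).

Definition lin_comb (a : C) (V : CT) (b : C) (W : CT) : CT :=
  mkCT (a * dz1 V + b * dz1 W)%C (a * dz1bar V + b * dz1bar W)%C
       (a * dz2 V + b * dz2 W)%C (a * dz2bar V + b * dz2bar W)%C.

Definition T01_Z (sigma : CR -> R) (p : CC) (V : CT) : Prop :=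
  exists a b : C, V = lin_comb a (Xi sigma p) b d_mubar.

Definition eta (sigma : CR -> R) (p : CC) (j : idx) : form1 :=
  let z := fst p in
  let mu := snd p in
  match j with
  | I1 => fun V =>
      (RtoC (exp (sigma z)) * (dz1 V - mu * mu * dz1bar V))%C
  | I2 => fun V =>
      (dz2 V + mu * (dz sigma z * dz1 V - dzbar sigma z * dz1bar V))%C
  end.

Definition Omega_Z (sigma : CR -> R) (p : CC) : form2 := sum_form (eta sigma p).

Definition holomorphic_blow_down_structure (sigma : CR -> R) (beta : CC -> CC)
    : Prop :=
  smooth_near Z beta /\
  totally_real_alpha_embedding sigma beta /\
  biholomorphic_onto_image Z_int (T01_Z sigma) T01_C2 beta /\
  exists c : R, 0 < c /\
    forall p, Z_int p ->
      form_le (eta sigma p)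
        (fun U V => (RtoC c * Omega_Z sigma p U V)%C)
        (pullback beta p Omega_C2).

Definition sigma_k (kappa : R) (z : CR) : R := - ln (1 + kappa * Cmod z ^ 2).

Lemma exp_2_sigma_k (kappa : R) (z : CR) :
  0 < 1 + kappa * Cmod z ^ 2 ->
  exp (2 * sigma_k kappa z) = / (1 + kappa * Cmod z ^ 2) ^ 2.
Proof.
  intros H. unfold sigma_k. set (u := 1 + kappa * Cmod z ^ 2) in *.
  replace (2 * - ln u) with (- (ln u + ln u)) by ring.
  rewrite exp_Ropp, exp_plus, !exp_ln by exact H. f_equal. ring.
Qed.

Definition beta_k (kappa : R) (p : CC) : CC :=
  let z := fst p in
  let mu := snd p in
  let den := (1 + RtoC kappa * (Cconj z * Cconj z) * (mu * mu))%C in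
  (((z - mu * mu * Cconj z) / den)%C,
   (mu * (RtoC (1 + kappa * Cmod z ^ 2) / den))%C).

(* Main.v *)
Require Import Defs.
From Stdlib Require Import Reals Lra Psatz ClassicalEpsilon.
From Coquelicot Require Import Coquelicot.
Open Scope R_scope.

(** On the unit circle bundle [beta] is constant along geodesics: its components
    are first integrals, and [h = beta] itself is the smooth extension of
    [f o F^(-1)].  At the points of the image of [F] the geodesic is transversal
    to the boundary of the larger disc, because the angular momentum
    [Im (conj z mu) / (1 + kappa |z|^2)] is conserved and cannot be as large as
    at a glancing point; there the image of the torus is totally real.  In the
    frame [eta], [d beta] is the matrix
    [q / den^2 * ((1 - kappa a^2, - 2 a), (2 kappa a, 1 - kappa a^2))] with
    [q = 1 + kappa |z|^2], [a = conj z mu], [den = 1 + kappa a^2], whose inverse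
    is bounded; this gives both holomorphy and the lower bound for the pulled
    back form.  The inverse of [beta] is explicit up to a quadratic equation. *)

(** * Calculus of smooth maps *)

(** The metric has constant curvature [4 kappa], and [w |-> (z + w) / (1 - kappa conj z w)] is an
    isometry taking 0 to [z]; applied to straight lines through 0 it gives the geodesics in closed
    form. The matrix of [d beta] is easy to invert because
    [(1 - kappa a^2)^2 + 4 kappa a^2 = den^2]: the inverse is a polynomial in [a] divided by [q],
    hence bounded up to the boundary of [Z]. Directions that glance the unit circle cause no
    trouble, because [(1 + kappa) r > 1 + kappa r^2] for such [r > 1], so that they cross the larger
    circle transversally. *)

Section Smooth_calculus.

Context {V : NormedModule R_AbsRing}.
Implicit Types (U : V -> Prop) (W : NormedModule R_AbsRing) (k : nat).

Lemma line_0 (p v : V) : plus p (scal 0 v) = p.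
Proof.
  rewrite (scal_zero_l v : scal 0 v = zero). apply plus_zero_r.
Qed.

Lemma continuous_line (p v : V) :
  continuous (fun t : R => plus p (scal t v)) 0.
Proof.
  apply (continuous_plus (fun _ : R => p) (fun t : R => scal t v)).
  - apply continuous_const.
  - apply (continuous_scal_l (fun t : R => t) v), continuous_id.
Qed.

Lemma locally_line U (p v : V) :
  open U -> U p -> locally 0 (fun t : R => U (plus p (scal t v))).
Proof.
  intros HU Hp. apply (continuous_line p v U).
  apply HU. now rewrite line_0.
Qed.

Lemma Ck_on_continuous {W} U k (f : V -> W) (p : V) :
  Ck_on U k f -> U p -> continuous f p.
Proof. destruct k; intros [Hc _] Hp; now apply Hc. Qed.

Lemma Ck_on_pred {W} U k (f : V -> W) : Ck_on U (S k) f -> Ck_on U k f.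
Proof.
  revert f; induction k as [|k IH]; intros f [Hc Hd]; split; auto.
  intros v. destruct (Hd v) as [g [Hg Hgk]]. exists g; auto.
Qed.

(** A derivative at a point of [U] sees values along a segment around it; openness of [U] makes the
    two maps agree there. *)
Lemma Ck_on_ext {W} U k (f g : V -> W) :
  open U -> (forall p, U p -> f p = g p) -> Ck_on U k f -> Ck_on U k g.
Proof.
  intros HU Hfg Hf.
  assert (Hc : forall p, U p -> continuous g p).
  { intros p Hp. apply (continuous_ext_loc g f p).
    - apply (locally_open U (fun y => f y = g y)); auto.
    - now apply (Ck_on_continuous U k). }
  destruct k as [|k]; split; auto.
  intros v. destruct Hf as [_ Hd], (Hd v) as [f' [Hf' Hk]].
  exists f'. split; auto. intros p Hp.
  apply is_derive_ext_loc with (fun t : R => f (plus p (scal t v))); auto.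
  eapply filter_imp; [|now apply (locally_line U p v)].
  intros t Ht; now apply Hfg.
Qed.

Lemma Ck_on_sub {W} U U' k (f : V -> W) :
  (forall p, U' p -> U p) -> Ck_on U k f -> Ck_on U' k f.
Proof.
  intros Hs. revert f; induction k as [|k IH]; intros f [Hc Hd]; split; auto.
  intros v. destruct (Hd v) as [g [Hg Hgk]]. exists g; auto.
Qed.

Lemma Ck_on_const {W} U k (c : W) : Ck_on U k (fun _ : V => c).
Proof.
  revert c; induction k as [|k IH]; intros c; split; auto;
    try (intros; apply continuous_const).
  intros v. exists (fun _ => zero). split; auto.
  intros p _. apply @is_derive_const.
Qed.

Lemma is_derive_linear {W W'} (l : W -> W') (f : R -> W) (t : R) (d : W) :
  is_linear l -> is_derive f t d -> is_derive (fun s => l (f s)) t (l d).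
Proof.
  intros Hl Hf.
  apply filterdiff_ext_lin with (fun s => l (scal s d)).
  - apply (filterdiff_comp' f l t (fun s => scal s d) l); auto.
    now apply filterdiff_linear.
  - intros s. now apply linear_scal.
Qed.

Lemma is_derive_line {W} (l : V -> W) (p v : V) :
  is_linear l -> is_derive (fun t : R => l (plus p (scal t v))) 0 (l v).
Proof.
  intros Hl. apply (is_derive_linear l (fun t : R => plus p (scal t v))); auto.
  evar_last.
  - apply @is_derive_plus; [apply @is_derive_const|].
    apply (is_derive_linear (W := R_NormedModule) (fun s => scal s v)).
    + exact (is_linear_scal_l v).
    + apply @is_derive_id.
  - rewrite plus_zero_l. apply scal_one.
Qed.

Lemma Ck_on_linear {W} U k (l : V -> W) : is_linear l -> Ck_on U k l.
Proof.
  intros Hl. destruct k as [|k]; split; auto;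
    try (intros; now apply linear_cont).
  intros v. exists (fun _ => l v). split.
  - intros p _. now apply is_derive_line.
  - apply Ck_on_const.
Qed.

(** A continuous linear map commutes with every directional derivative. Sums, opposites, real and
    imaginary parts are instances, a sum being addition composed with a pairing. *)
Lemma Ck_on_comp_linear {W W'} U k (l : W -> W') (f : V -> W) :
  is_linear l -> Ck_on U k f -> Ck_on U k (fun p => l (f p)).
Proof.
  intros Hl. revert f; induction k as [|k IH]; intros f [Hc Hd]; split; auto.
  1,2: intros p Hp; apply (continuous_comp f l); auto; now apply linear_cont.
  intros v. destruct (Hd v) as [g [Hg Hgk]]. exists (fun p => l (g p)).
  split; auto. intros p Hp.
  now apply (is_derive_linear l (fun t : R => f (plus p (scal t v)))), Hg.
Qed.

Lemma is_derive_pair {W W'} (f : R -> W) (g : R -> W') (t : R) (a : W) (b : W') :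
  is_derive f t a -> is_derive g t b ->
  is_derive (V := prod_NormedModule R_AbsRing W W') (fun s => (f s, g s)) t (a, b).
Proof.
  intros Hf Hg.
  apply (filterdiff_comp'_2 f g (fun u v => (u, v)) t
           (fun s => scal s a) (fun s => scal s b) (fun u v => (u, v))); auto.
  apply filterdiff_ext_lin with (fun t => t); [|now intros []].
  apply filterdiff_ext with (fun t => t); [now intros []|].
  apply filterdiff_id.
Qed.

Lemma continuous_pair {W W'} (f : V -> W) (g : V -> W') (p : V) :
  continuous f p -> continuous g p ->
  continuous (U := prod_NormedModule R_AbsRing W W') (fun q => (f q, g q)) p.
Proof.
  intros Hf Hg. apply (continuous_comp_2 f g (fun u v => (u, v))); auto.
  apply (continuous_ext (fun t => t)); [now intros []|apply continuous_id].
Qed.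

Lemma Ck_on_pair {W W'} U k (f : V -> W) (g : V -> W') :
  Ck_on U k f -> Ck_on U k g ->
  Ck_on (W := prod_NormedModule R_AbsRing W W') U k (fun p => (f p, g p)).
Proof.
  revert f g; induction k as [|k IH]; intros f g [Hc Hd] [Hc' Hd']; split; auto.
  1,2: intros p Hp; apply continuous_pair; auto.
  intros v. destruct (Hd v) as [a [Ha Hak]], (Hd' v) as [b [Hb Hbk]].
  exists (fun p => (a p, b p)). split; auto.
  intros p Hp. apply is_derive_pair; auto.
Qed.

Lemma Ck_on_plus {W} U k (f g : V -> W) :
  Ck_on U k f -> Ck_on U k g -> Ck_on U k (fun p => plus (f p) (g p)).
Proof.
  intros Hf Hg.
  apply (Ck_on_comp_linear (W := prod_NormedModule R_AbsRing W W) U k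
           (fun u => plus (fst u) (snd u)) (fun p => (f p, g p))).
  - apply is_linear_plus.
  - now apply Ck_on_pair.
Qed.

Notation RM := R_NormedModule.

Lemma Ck_on_mult U k (f g : V -> RM) :
  Ck_on U k f -> Ck_on U k g -> Ck_on (W := RM) U k (fun p => f p * g p).
Proof.
  revert f g; induction k as [|k IH]; intros f g Hf Hg;
    pose proof (fun p => Ck_on_continuous U _ f p Hf);
    pose proof (fun p => Ck_on_continuous U _ g p Hg); split; auto.
  1,2: intros p Hp; apply (continuous_mult f g); auto.
  pose proof (Ck_on_pred _ _ _ Hf); pose proof (Ck_on_pred _ _ _ Hg).
  intros v. destruct Hf as [_ Hf], Hg as [_ Hg].
  destruct (Hf v) as [a [Ha Hak]], (Hg v) as [b [Hb Hbk]].
  exists (fun p => plus (a p * g p) (f p * b p)). split.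
  - intros p Hp. evar_last.
    + apply @is_derive_mult; [now apply Ha|now apply Hb|apply Rmult_comm].
    + cbv beta. now rewrite line_0.
  - apply @Ck_on_plus; auto.
Qed.

(** The derivative [- f' / f^2] contains [/ f] again, which the induction hypothesis provides one
    order lower. The square root follows the same scheme; for [ln] the derivative is [f' / f] and no
    induction is left. *)
Lemma Ck_on_inv U k (f : V -> RM) :
  (forall p, U p -> f p <> 0) ->
  Ck_on U k f -> Ck_on (W := RM) U k (fun p => / f p).
Proof.
  intros H0. induction k as [|k IH]; intros Hf;
    pose proof (fun p => Ck_on_continuous U _ f p Hf); split; auto.
  1,2: intros p Hp; apply (continuous_comp f Rinv); auto;
    apply continuous_Rinv; auto.
  pose proof (Ck_on_pred _ _ _ Hf).
  intros v. destruct Hf as [_ Hf]. destruct (Hf v) as [a [Ha Hak]].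
  exists (fun p => a p * (-1 * (/ f p * / f p))). split.
  - intros p Hp. evar_last.
    + apply is_derive_inv; [now apply Ha|]. rewrite line_0; auto.
    + cbv beta. rewrite line_0. simpl. field. auto.
  - apply Ck_on_mult; auto. apply Ck_on_mult; [apply Ck_on_const|].
    apply Ck_on_mult; auto.
Qed.

Lemma Ck_on_ln U k (f : V -> RM) :
  (forall p, U p -> 0 < f p) ->
  Ck_on U k f -> Ck_on (W := RM) U k (fun p => ln (f p)).
Proof.
  intros H0. destruct k as [|k]; intros Hf;
    pose proof (fun p => Ck_on_continuous U _ f p Hf); split; auto.
  1,2: intros p Hp; apply (continuous_comp f ln); auto;
    apply @ex_derive_continuous; exists (/ f p); apply is_derive_ln; auto.
  pose proof (Ck_on_pred _ _ _ Hf).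
  intros v. destruct Hf as [_ Hf]. destruct (Hf v) as [a [Ha Hak]].
  exists (fun p => a p * / f p). split.
  - intros p Hp. evar_last.
    + apply (is_derive_comp ln); [|now apply Ha].
      apply is_derive_ln. rewrite line_0; auto.
    + cbv beta. now rewrite line_0.
  - apply Ck_on_mult; auto. apply Ck_on_inv; auto.
    intros p Hp. apply Rgt_not_eq, H0; auto.
Qed.

Lemma Ck_on_sqrt U k (f : V -> RM) :
  (forall p, U p -> 0 < f p) ->
  Ck_on U k f -> Ck_on (W := RM) U k (fun p => sqrt (f p)).
Proof.
  intros H0. induction k as [|k IH]; intros Hf;
    pose proof (fun p => Ck_on_continuous U _ f p Hf); split; auto.
  1,2: intros p Hp; apply (continuous_comp f sqrt); auto; apply continuous_sqrt.
  pose proof (Ck_on_pred _ _ _ Hf).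
  intros v. destruct Hf as [_ Hf]. destruct (Hf v) as [a [Ha Hak]].
  exists (fun p => a p * / (2 * sqrt (f p))). split.
  - intros p Hp. evar_last.
    + apply is_derive_sqrt; [now apply Ha|]. rewrite line_0; auto.
    + cbv beta. now rewrite line_0.
  - apply Ck_on_mult; auto. apply Ck_on_inv.
    + intros p Hp. specialize (H0 p Hp). apply sqrt_lt_R0 in H0. lra.
    + apply Ck_on_mult; auto. apply Ck_on_const.
Qed.

End Smooth_calculus.

Lemma is_linear_Re : is_linear (U := CR) (V := R_NormedModule) Re.
Proof. apply (is_linear_fst (U := R_NormedModule) (V := R_NormedModule)). Qed.

Lemma is_linear_Im : is_linear (U := CR) (V := R_NormedModule) Im.
Proof. apply (is_linear_snd (U := R_NormedModule) (V := R_NormedModule)). Qed.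

(** * Smoothness of real- and complex-valued functions *)

Section Smooth_functions.

Context {V : NormedModule R_AbsRing} (U : V -> Prop).
Notation RM := R_NormedModule.

Lemma smooth_on_const {W : NormedModule R_AbsRing} (c : W) :
  smooth_on U (fun _ => c).
Proof. intro k; apply Ck_on_const. Qed.

Lemma smooth_on_linear {W : NormedModule R_AbsRing} (l : V -> W) :
  is_linear l -> smooth_on U l.
Proof. intros Hl k; now apply Ck_on_linear. Qed.

Lemma smooth_on_pair {W W' : NormedModule R_AbsRing} (f : V -> W) (g : V -> W') :
  smooth_on U f -> smooth_on U g ->
  smooth_on (W := prod_NormedModule R_AbsRing W W') U (fun p => (f p, g p)).
Proof. intros Hf Hg k. now apply Ck_on_pair. Qed.

Lemma smooth_on_continuous {W : NormedModule R_AbsRing} (f : V -> W) (p : V) :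
  smooth_on U f -> U p -> continuous f p.
Proof. intros Hf. apply Ck_on_continuous with 0%nat, Hf. Qed.

Lemma smooth_on_Rplus (f g : V -> RM) :
  smooth_on U f -> smooth_on U g -> smooth_on (W := RM) U (fun p => f p + g p).
Proof. intros Hf Hg k. now apply (Ck_on_plus U k f g). Qed.

Lemma smooth_on_Rmult (f g : V -> RM) :
  smooth_on U f -> smooth_on U g -> smooth_on (W := RM) U (fun p => f p * g p).
Proof. intros Hf Hg k. now apply Ck_on_mult. Qed.

Lemma smooth_on_Ropp (f : V -> RM) :
  smooth_on U f -> smooth_on (W := RM) U (fun p => - f p).
Proof. intros Hf k. apply (Ck_on_comp_linear U k opp f); auto. apply is_linear_opp. Qed.

Lemma smooth_on_Rminus (f g : V -> RM) :
  smooth_on U f -> smooth_on U g -> smooth_on (W := RM) U (fun p => f p - g p).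
Proof. intros Hf Hg. apply smooth_on_Rplus; auto. now apply smooth_on_Ropp. Qed.

Lemma smooth_on_Rinv (f : V -> RM) :
  (forall p, U p -> f p <> 0) ->
  smooth_on U f -> smooth_on (W := RM) U (fun p => / f p).
Proof. intros H0 Hf k. now apply Ck_on_inv. Qed.

Lemma smooth_on_ln (f : V -> RM) :
  (forall p, U p -> 0 < f p) ->
  smooth_on U f -> smooth_on (W := RM) U (fun p => ln (f p)).
Proof. intros H0 Hf k. now apply Ck_on_ln. Qed.

Lemma smooth_on_sqrt (f : V -> RM) :
  (forall p, U p -> 0 < f p) ->
  smooth_on U f -> smooth_on (W := RM) U (fun p => sqrt (f p)).
Proof. intros H0 Hf k. now apply Ck_on_sqrt. Qed.

Lemma smooth_on_Re (f : V -> CR) :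
  smooth_on U f -> smooth_on (W := RM) U (fun p => Re (f p)).
Proof.
  intros Hf k. apply (Ck_on_comp_linear U k (W := CR) Re f); auto.
  apply is_linear_Re.
Qed.

Lemma smooth_on_Im (f : V -> CR) :
  smooth_on U f -> smooth_on (W := RM) U (fun p => Im (f p)).
Proof.
  intros Hf k. apply (Ck_on_comp_linear U k (W := CR) Im f); auto.
  apply is_linear_Im.
Qed.

Lemma smooth_on_C (f g : V -> RM) :
  smooth_on U f -> smooth_on U g -> smooth_on (W := CR) U (fun p => (f p, g p)).
Proof. apply smooth_on_pair. Qed.

Lemma smooth_on_RtoC (f : V -> RM) :
  smooth_on U f -> smooth_on (W := CR) U (fun p => RtoC (f p)).
Proof. intros Hf. apply smooth_on_C; auto. apply smooth_on_const. Qed.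

Lemma smooth_on_Cconj (f : V -> CR) :
  smooth_on U f -> smooth_on (W := CR) U (fun p => Cconj (f p)).
Proof.
  intros Hf. apply smooth_on_C.
  - now apply smooth_on_Re.
  - now apply (smooth_on_Ropp (fun p => Im (f p))), smooth_on_Im.
Qed.

Lemma smooth_on_Cplus (f g : V -> CR) :
  smooth_on U f -> smooth_on U g -> smooth_on (W := CR) U (fun p => f p + g p)%C.
Proof. intros Hf Hg k. now apply (Ck_on_plus U k f g). Qed.

Lemma smooth_on_Cminus (f g : V -> CR) :
  smooth_on U f -> smooth_on U g -> smooth_on (W := CR) U (fun p => f p - g p)%C.
Proof.
  intros Hf Hg k. apply (Ck_on_plus U k f (fun p => opp (g p))); [apply Hf|].
  apply (Ck_on_comp_linear U k opp g); auto. apply is_linear_opp.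
Qed.

Lemma smooth_on_Cmult (f g : V -> CR) :
  smooth_on U f -> smooth_on U g -> smooth_on (W := CR) U (fun p => f p * g p)%C.
Proof.
  intros Hf Hg.
  pose proof (smooth_on_Re f Hf). pose proof (smooth_on_Im f Hf).
  pose proof (smooth_on_Re g Hg). pose proof (smooth_on_Im g Hg).
  apply smooth_on_C.
  - apply (smooth_on_Rminus (fun p => Re (f p) * Re (g p))
                            (fun p => Im (f p) * Im (g p)));
      now apply smooth_on_Rmult.
  - apply (smooth_on_Rplus (fun p => Re (f p) * Im (g p))
                           (fun p => Im (f p) * Re (g p)));
      now apply smooth_on_Rmult.
Qed.

Lemma C_neq_0_sqr (z : C) : z <> RtoC 0 -> Re z ^ 2 + Im z ^ 2 <> 0.
Proof.
  intros Hz H. apply Hz. destruct z as [x y]. simpl in H.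
  apply injective_projections; simpl; nra.
Qed.

Lemma smooth_on_Cinv (f : V -> CR) :
  (forall p, U p -> f p <> RtoC 0) ->
  smooth_on U f -> smooth_on (W := CR) U (fun p => / f p)%C.
Proof.
  intros H0 Hf.
  pose proof (smooth_on_Re f Hf). pose proof (smooth_on_Im f Hf).
  assert (smooth_on (W := RM) U (fun p => / (Re (f p) ^ 2 + Im (f p) ^ 2))).
  { apply smooth_on_Rinv.
    - intros p Hp. apply C_neq_0_sqr; auto.
    - apply smooth_on_Rplus;
        repeat (apply smooth_on_Rmult; auto); apply (smooth_on_const (W := RM)). }
  apply smooth_on_C.
  - now apply (smooth_on_Rmult (fun p => Re (f p))).
  - apply (smooth_on_Rmult (fun p => - Im (f p))); auto. now apply smooth_on_Ropp.
Qed.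

Lemma smooth_on_Cdiv (f g : V -> CR) :
  (forall p, U p -> g p <> RtoC 0) ->
  smooth_on U f -> smooth_on U g -> smooth_on (W := CR) U (fun p => f p / g p)%C.
Proof. intros H0 Hf Hg. apply smooth_on_Cmult; auto. now apply smooth_on_Cinv. Qed.

(** [Cmod] is a square root and not smooth at 0, while its square is a polynomial in the real
    coordinates. The domains below are therefore cut out by squared moduli. *)
Lemma smooth_on_Cmod2 (f : V -> CR) :
  open U -> smooth_on U f -> smooth_on (W := RM) U (fun p => Cmod (f p) ^ 2).
Proof.
  intros HU Hf k.
  apply Ck_on_ext with (fun p => Re (f p) * Re (f p) + Im (f p) * Im (f p)); auto.
  - intros p _. match goal with |- ?a = ?b => change (@eq R a b) end.
    rewrite Cmod2_alt. simpl. ring.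
  - revert k. pose proof (smooth_on_Re f Hf). pose proof (smooth_on_Im f Hf).
    apply smooth_on_Rplus; now apply smooth_on_Rmult.
Qed.

End Smooth_functions.

Arguments smooth_on_const {V U W} c.
Arguments smooth_on_linear {V U W} l _.
Arguments smooth_on_pair {V U W W'} f g _ _.

(** * Derivatives of complex-valued curves *)

Section Complex_valued_curves.

Notation is_Cderive := (is_derive (K := R_AbsRing) (V := CR)).
Implicit Types (f g : R -> CR) (t : R) (a b : C).

Lemma is_derive_Re f t a :
  is_Cderive f t a -> is_derive (fun s => Re (f s)) t (Re a).
Proof. apply (is_derive_linear (W := CR) (W' := R_NormedModule) Re), is_linear_Re. Qed.

Lemma is_derive_Im f t a :
  is_Cderive f t a -> is_derive (fun s => Im (f s)) t (Im a).
Proof. apply (is_derive_linear (W := CR) (W' := R_NormedModule) Im), is_linear_Im. Qed.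

Lemma is_Cderive_C (u v : R -> R) t (x y : R) :
  is_derive u t x -> is_derive v t y -> is_Cderive (fun s => (u s, v s)) t (x, y).
Proof. apply (is_derive_pair (W := R_NormedModule) (W' := R_NormedModule)). Qed.

Lemma is_Cderive_const (c : C) t : is_Cderive (fun _ => c) t (RtoC 0).
Proof. apply @is_derive_const. Qed.

Lemma is_Cderive_RtoC (u : R -> R) t (x : R) :
  is_derive u t x -> is_Cderive (fun s => RtoC (u s)) t (RtoC x).
Proof. intros Hu. apply is_Cderive_C; auto. apply @is_derive_const. Qed.

Lemma is_Cderive_plus f g t a b :
  is_Cderive f t a -> is_Cderive g t b ->
  is_Cderive (fun s => f s + g s)%C t (a + b)%C.
Proof. apply @is_derive_plus. Qed.

Lemma is_Cderive_opp f t a :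
  is_Cderive f t a -> is_Cderive (fun s => - f s)%C t (- a)%C.
Proof. apply @is_derive_opp. Qed.

Lemma is_Cderive_minus f g t a b :
  is_Cderive f t a -> is_Cderive g t b ->
  is_Cderive (fun s => f s - g s)%C t (a - b)%C.
Proof. intros Hf Hg. apply is_Cderive_plus; auto. now apply is_Cderive_opp. Qed.

Lemma is_Cderive_mult f g t a b :
  is_Cderive f t a -> is_Cderive g t b ->
  is_Cderive (fun s => f s * g s)%C t (a * g t + f t * b)%C.
Proof.
  intros Hf Hg.
  pose proof (is_derive_Re _ _ _ Hf). pose proof (is_derive_Im _ _ _ Hf).
  pose proof (is_derive_Re _ _ _ Hg). pose proof (is_derive_Im _ _ _ Hg).
  evar_last.
  - apply is_Cderive_C.
    + apply @is_derive_minus; apply @is_derive_mult; eauto; apply Rmult_comm.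
    + apply @is_derive_plus; apply @is_derive_mult; eauto; apply Rmult_comm.
  - unfold minus, plus, opp, mult; simpl.
    apply injective_projections; simpl; unfold Re, Im; ring.
Qed.

Lemma is_Cderive_conj f t a :
  is_Cderive f t a -> is_Cderive (fun s => Cconj (f s)) t (Cconj a).
Proof.
  intros Hf. apply is_Cderive_C.
  - now apply is_derive_Re.
  - apply @is_derive_opp. now apply is_derive_Im.
Qed.

Lemma is_Cderive_inv f t a :
  is_Cderive f t a -> f t <> RtoC 0 ->
  is_Cderive (fun s => / f s)%C t (- a / (f t * f t))%C.
Proof.
  intros Hf H0. apply C_neq_0_sqr in H0.
  pose proof (is_derive_Re _ _ _ Hf) as Hr. pose proof (is_derive_Im _ _ _ Hf) as Hi.
  evar_last.
  - apply is_Cderive_C.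
    + apply (is_derive_div (fun s => Re (f s)) (fun s => Re (f s) ^ 2 + Im (f s) ^ 2));
        [exact Hr| |exact H0].
      apply @is_derive_plus; apply @is_derive_pow; eassumption.
    + apply (is_derive_div (fun s => - Im (f s)) (fun s => Re (f s) ^ 2 + Im (f s) ^ 2));
        [apply @is_derive_opp; exact Hi| |exact H0].
      apply @is_derive_plus; apply @is_derive_pow; eassumption.
  - unfold plus, opp; simpl. destruct (f t) as [x y], a as [u v]; simpl in *.
    rewrite !Rmult_1_r in H0.
    assert ((x * x - y * y) * (x * x - y * y) + (x * y + y * x) * (x * y + y * x)
            <> 0).
    { replace (_ + _) with ((x * x + y * y) ^ 2) by ring.
      now apply pow_nonzero. }
    apply injective_projections; simpl; field; auto.
Qed.

Lemma is_Cderive_div f g t a b :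
  is_Cderive f t a -> is_Cderive g t b -> g t <> RtoC 0 ->
  is_Cderive (fun s => f s / g s)%C t ((a * g t - f t * b) / (g t * g t))%C.
Proof.
  intros Hf Hg H0. evar_last.
  - apply (is_Cderive_mult f (fun s => / g s)%C t a (- b / (g t * g t))%C Hf).
    now apply is_Cderive_inv.
  - simpl. field. auto.
Qed.

(** The left side has the shape of [dir_deriv], so this turns the derivative of a complex-valued
    curve into a value of [dir_deriv]. *)
Lemma is_Cderive_unique f t a :
  is_Cderive f t a ->
  (Derive (fun s => Re (f s)) t, Derive (fun s => Im (f s)) t) = a.
Proof.
  intros Hf. apply injective_projections; simpl; apply is_derive_unique.
  - now apply is_derive_Re.
  - now apply is_derive_Im.
Qed.

End Complex_valued_curves.

(** * The differential of beta *)

Definition den (kappa : R) (z m : C) : C :=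
  (1 + RtoC kappa * (Cconj z * Cconj z) * (m * m))%C.

(** Written with [z * Cconj z] instead of [Cmod], so that [ring] and [field] see a polynomial. *)
Definition conf (kappa : R) (z : C) : C := (1 + RtoC kappa * (z * Cconj z))%C.

Lemma conf_RtoC (kappa : R) (z : C) :
  RtoC (1 + kappa * Cmod z ^ 2) = conf kappa z.
Proof.
  unfold conf. rewrite <- Cmod2_conj, RtoC_plus, RtoC_mult, RtoC_pow.
  reflexivity.
Qed.

(** [e1] and [e2] are the forms [eta_1] and [eta_2] times [1 + kappa |z|^2], and
    [dbeta1], [dbeta2] the complexified differentials of the components of
    [beta]; [u'] stands for the d/d(conj z)-component. *)
Definition e1 (m u u' : C) : C := (u - m * m * u')%C.

Definition e2 (kappa : R) (z m u u' v : C) : C :=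
  (conf kappa z * v - m * RtoC kappa * (Cconj z * u - z * u'))%C.

Definition dbeta1 (kappa : R) (z m u u' v : C) : C :=
  (((1 - RtoC kappa * (Cconj z * m) * (Cconj z * m)) * e1 m u u'
    - 2 * (Cconj z * m) * e2 kappa z m u u' v)
   / (den kappa z m * den kappa z m))%C.

Definition dbeta2 (kappa : R) (z m u u' v : C) : C :=
  ((2 * RtoC kappa * (Cconj z * m) * e1 m u u'
    + (1 - RtoC kappa * (Cconj z * m) * (Cconj z * m)) * e2 kappa z m u u' v)
   / (den kappa z m * den kappa z m))%C.

(** With [a = conj z m], the determinant [(1 - kappa a^2)^2 + 4 kappa a^2] equals [den^2] and
    cancels the denominator. *)
Lemma dbeta_inv (kappa : R) (z m u u' v : C) :
  den kappa z m <> RtoC 0 ->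
  let x := (1 - RtoC kappa * (Cconj z * m) * (Cconj z * m))%C in
  e1 m u u' = (x * dbeta1 kappa z m u u' v
               + 2 * (Cconj z * m) * dbeta2 kappa z m u u' v)%C /\
  e2 kappa z m u u' v = (x * dbeta2 kappa z m u u' v
               - 2 * RtoC kappa * (Cconj z * m) * dbeta1 kappa z m u u' v)%C.
Proof.
  intros H x. unfold dbeta1, dbeta2, x.
  generalize (e1 m u u') (e2 kappa z m u u' v). intros a b.
  unfold den in *. split; field; exact H.
Qed.

Section Derivative.

Variable kappa : R.
Notation is_Cderive := (is_derive (K := R_AbsRing) (V := CR)).

(** Along a real curve the d/d(conj z)-component of the velocity is the conjugate of [u]. Arbitrary
    curves are allowed because the lemma is applied both to straight lines and to curves in the
    image of the inverse of [beta]. *)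
Lemma is_Cderive_beta (z m : R -> CR) (t : R) (u v : C) :
  is_Cderive z t u -> is_Cderive m t v -> den kappa (z t) (m t) <> RtoC 0 ->
  is_Cderive (fun s => fst (beta_k kappa (z s, m s))) t
    (dbeta1 kappa (z t) (m t) u (Cconj u) v) /\
  is_Cderive (fun s => snd (beta_k kappa (z s, m s))) t
    (dbeta2 kappa (z t) (m t) u (Cconj u) v).
Proof.
  intros Hz Hm Hd.
  pose proof (is_Cderive_conj _ _ _ Hz) as Hz'.
  pose proof (is_Cderive_mult _ _ _ _ _ Hm Hm) as Hmm.
  assert (Hden := is_Cderive_plus _ _ _ _ _ (is_Cderive_const (RtoC 1) t)
    (is_Cderive_mult _ _ _ _ _
      (is_Cderive_mult _ _ _ _ _ (is_Cderive_const (RtoC kappa) t)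
        (is_Cderive_mult _ _ _ _ _ Hz' Hz')) Hmm)).
  assert (Hconf := is_Cderive_plus _ _ _ _ _ (is_Cderive_const (RtoC 1) t)
      (is_Cderive_mult _ _ _ _ _ (is_Cderive_const (RtoC kappa) t)
        (is_Cderive_mult _ _ _ _ _ Hz Hz'))).
  cbv beta in Hden, Hconf. split.
  - evar_last.
    + apply (is_Cderive_div _ _ _ _ _
        (is_Cderive_minus _ _ _ _ _ Hz (is_Cderive_mult _ _ _ _ _ Hmm Hz'))
        Hden Hd).
    + cbv beta. unfold dbeta1, e1, e2, conf, den in *. field. exact Hd.
  - apply is_derive_ext with
      (fun s => (m s * (conf kappa (z s) / den kappa (z s) (m s)))%C).
    { intros s. cbv beta. unfold beta_k. cbv zeta. cbn [fst snd].
      now rewrite conf_RtoC. }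
    evar_last.
    + apply (is_Cderive_mult _ _ _ _ _ Hm (is_Cderive_div _ _ _ _ _ Hconf Hden Hd)).
    + cbv beta. unfold dbeta2, e1, e2, conf, den in *. field. exact Hd.
Qed.

Lemma dir_deriv_beta (p v : CC) :
  den kappa (fst p) (snd p) <> RtoC 0 ->
  dir_deriv (fun q => fst (beta_k kappa q)) p v
    = dbeta1 kappa (fst p) (snd p) (fst v) (Cconj (fst v)) (snd v) /\
  dir_deriv (fun q => snd (beta_k kappa q)) p v
    = dbeta2 kappa (fst p) (snd p) (fst v) (Cconj (fst v)) (snd v).
Proof.
  intros Hd.
  assert (H := is_Cderive_beta (fun t => fst (plus p (scal t v)))
    (fun t => snd (plus p (scal t v))) 0 (fst v) (snd v)).
  cbv beta in H. rewrite (line_0 p v) in H.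
  destruct H as [H1 H2]; auto.
  - apply (is_derive_line (V := CC) (W := CR) fst), is_linear_fst.
  - apply (is_derive_line (V := CC) (W := CR) snd), is_linear_snd.
  - split; now apply is_Cderive_unique.
Qed.

End Derivative.

Lemma dir_deriv_conj (f : CC -> C) (p v : CC) :
  dir_deriv (fun q => Cconj (f q)) p v = Cconj (dir_deriv f p v).
Proof.
  apply injective_projections; simpl; [reflexivity|].
  apply (Derive_opp (fun t => Im (f (plus p (scal t v))))).
Qed.

(** The operators [d1], [d1bar], [d2], [d2bar] recover the four coefficients of a real-linear
    differential from its values in the directions 1 and i of each factor. *)
Lemma act_real_linear (f : CC -> C) (p : CC) (a a' b b' : C) (X : CT) :
  (forall v, dir_deriv f p v
     = a * fst v + a' * Cconj (fst v) + b * snd v + b' * Cconj (snd v))%C ->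
  act X f p = (a * dz1 X + a' * dz1bar X + b * dz2 X + b' * dz2bar X)%C.
Proof.
  intros H. unfold act, Defs.d1, d1bar, Defs.d2, d2bar.
  rewrite (H (RtoC 1, RtoC 0)), (H (Ci, RtoC 0)), (H (RtoC 0, RtoC 1)),
    (H (RtoC 0, Ci)).
  destruct a, a', b, b', X as [[] [] [] []].
  apply injective_projections; simpl; field.
Qed.

(** Conjugating a function conjugates the coefficients of its differential and exchanges barred and
    unbarred ones, which is what [conj_vec] does to the vector. *)
Lemma act_real_linear_conj (f : CC -> C) (p : CC) (a a' b b' : C) (X : CT) :
  (forall v, dir_deriv f p v
     = a * fst v + a' * Cconj (fst v) + b * snd v + b' * Cconj (snd v))%C ->
  act X (fun q => Cconj (f q)) p = Cconj (act (conj_vec X) f p).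
Proof.
  intros H. rewrite (act_real_linear f p a a' b b') by exact H.
  rewrite (act_real_linear _ p (Cconj a') (Cconj a) (Cconj b') (Cconj b)).
  - unfold conj_vec; simpl.
    rewrite !Cplus_conj, !Cmult_conj, !Cconj_conj. ring.
  - intros v. rewrite dir_deriv_conj, H.
    rewrite !Cplus_conj, !Cmult_conj, !Cconj_conj. ring.
Qed.

Lemma push_beta (kappa : R) (p : CC) (X : CT) :
  den kappa (fst p) (snd p) <> RtoC 0 ->
  push (beta_k kappa) p X =
    mkCT (dbeta1 kappa (fst p) (snd p) (dz1 X) (dz1bar X) (dz2 X))
      (Cconj (dbeta1 kappa (fst p) (snd p)
         (Cconj (dz1bar X)) (Cconj (dz1 X)) (Cconj (dz2bar X))))
      (dbeta2 kappa (fst p) (snd p) (dz1 X) (dz1bar X) (dz2 X))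
      (Cconj (dbeta2 kappa (fst p) (snd p)
         (Cconj (dz1bar X)) (Cconj (dz1 X)) (Cconj (dz2bar X)))).
Proof.
  intros Hd.
  pose (b1 := dbeta1 kappa (fst p) (snd p)).
  pose (b2 := dbeta2 kappa (fst p) (snd p)).
  (* [beta] involves [conj z] but not [conj mu], whence the last coefficient 0; the others are
     values of [dbeta1] at unit arguments. *)
  assert (H1 : forall v, dir_deriv (fun q => fst (beta_k kappa q)) p v =
    (b1 1 0 0 * fst v + b1 0 1 0 * Cconj (fst v) + b1 0 0 1 * snd v
     + RtoC 0 * Cconj (snd v))%C).
  { intros v. rewrite (proj1 (dir_deriv_beta kappa p v Hd)).
    unfold b1, dbeta1, e1, e2. field. exact Hd. }
  assert (H2 : forall v, dir_deriv (fun q => snd (beta_k kappa q)) p v =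
    (b2 1 0 0 * fst v + b2 0 1 0 * Cconj (fst v) + b2 0 0 1 * snd v
     + RtoC 0 * Cconj (snd v))%C).
  { intros v. rewrite (proj2 (dir_deriv_beta kappa p v Hd)).
    unfold b2, dbeta2, e1, e2. field. exact Hd. }
  unfold push.
  rewrite (act_real_linear_conj _ _ _ _ _ _ _ H1),
    (act_real_linear_conj _ _ _ _ _ _ _ H2).
  rewrite !(act_real_linear _ _ _ _ _ _ _ H1), !(act_real_linear _ _ _ _ _ _ _ H2).
  unfold b1, b2, conj_vec, dbeta1, dbeta2, e1, e2; simpl.
  f_equal; [|f_equal| |f_equal]; field; exact Hd.
Qed.

(** * The complex structure of the twistor space *)

Lemma Cmod_conj_mult (z m : C) : Cmod (Cconj z * m)%C = Cmod z * Cmod m.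
Proof. now rewrite Cmod_mult, Cmod_conj. Qed.

Lemma one_plus_neq_0 (z : C) : Cmod z < 1 -> (1 + z)%C <> RtoC 0.
Proof.
  intros Hz H.
  replace z with ((1 + z) - 1)%C in Hz by ring.
  rewrite H in Hz. replace (0 - 1)%C with (- (1))%C in Hz by ring.
  rewrite Cmod_m1 in Hz. lra.
Qed.

(** Stated with the product of the moduli, to serve both on [Z], where they are at most 1, and on
    the torus [|z| = r], [|mu| = 1]. *)
Lemma den_neq_0 (kappa : R) (z m : C) :
  Rabs kappa * (Cmod z * Cmod m) ^ 2 < 1 -> den kappa z m <> RtoC 0.
Proof.
  intros H. apply one_plus_neq_0.
  rewrite !Cmod_mult, Cmod_R, !Cmod_conj. eapply Rle_lt_trans; [|exact H].
  apply Req_le. ring.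
Qed.

Section Disc.

Variable kappa : R.

Lemma dz_sigma_k (z : C) :
  0 < 1 + kappa * Cmod z ^ 2 ->
  dz (sigma_k kappa) z = (- (RtoC kappa * Cconj z / conf kappa z))%C.
Proof.
  intros Hq. rewrite <- conf_RtoC. destruct z as [x y].
  assert (Hs : forall u v : R, sigma_k kappa (u, v)
    = - ln (1 + kappa * (u * u + v * v))).
  { intros u v. unfold sigma_k. rewrite Cmod2_alt. simpl. do 4 f_equal. ring. }
  rewrite Cmod2_alt in *. simpl in Hq.
  assert (Hq' : 0 < 1 + kappa * (x * x + y * y)) by lra.
  unfold dz.
  rewrite (is_derive_unique _ 0 (- (2 * kappa * x / (1 + kappa * (x * x + y * y))))),
    (is_derive_unique _ 0 (- (2 * kappa * y / (1 + kappa * (x * x + y * y))))).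
  - apply injective_projections; simpl; field; nra.
  - apply is_derive_ext with
      (fun t => - ln (1 + kappa * (x * x + (y + t) * (y + t)))).
    + intros t. rewrite <- Hs. f_equal. apply injective_projections; simpl; ring.
    + auto_derive; rewrite ?Rplus_0_r; [exact Hq'|field; lra].
  - apply is_derive_ext with
      (fun t => - ln (1 + kappa * ((x + t) * (x + t) + y * y))).
    + intros t. rewrite <- Hs. f_equal. apply injective_projections; simpl; ring.
    + auto_derive; rewrite ?Rplus_0_r; [exact Hq'|field; lra].
Qed.

Lemma exp_sigma_k (z : C) :
  0 < 1 + kappa * Cmod z ^ 2 ->
  exp (sigma_k kappa z) = / (1 + kappa * Cmod z ^ 2) /\
  exp (- sigma_k kappa z) = 1 + kappa * Cmod z ^ 2.
Proof.
  intros Hq. unfold sigma_k. rewrite Ropp_involutive, exp_Ropp, exp_ln by auto.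
  auto.
Qed.

Lemma conf_conj (z : C) : Cconj (conf kappa z) = conf kappa z.
Proof.
  rewrite <- conf_RtoC. apply injective_projections; simpl; ring.
Qed.

Lemma conf_neq_0 (z : C) :
  0 < 1 + kappa * Cmod z ^ 2 -> conf kappa z <> RtoC 0.
Proof.
  intros Hq. rewrite <- conf_RtoC. intros H. apply RtoC_inj in H. lra.
Qed.

Lemma eta_e (p : CC) (X : CT) :
  0 < 1 + kappa * Cmod (fst p) ^ 2 ->
  eta (sigma_k kappa) p I1 X = (e1 (snd p) (dz1 X) (dz1bar X) / conf kappa (fst p))%C /\
  eta (sigma_k kappa) p I2 X =
    (e2 kappa (fst p) (snd p) (dz1 X) (dz1bar X) (dz2 X) / conf kappa (fst p))%C.
Proof.
  intros Hq. pose proof (conf_neq_0 _ Hq) as H0. unfold eta, dzbar.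
  rewrite dz_sigma_k, (proj1 (exp_sigma_k _ Hq)), RtoC_inv, conf_RtoC; auto;
    [|lra].
  rewrite Copp_conj, Cdiv_conj, conf_conj, Cmult_conj, Cconj_conj; auto.
  replace (Cconj (RtoC kappa)) with (RtoC kappa)
    by (apply injective_projections; simpl; ring).
  unfold e1, e2. split; field; auto.
Qed.

(** Equations replace spanning vectors: [eta_1 = 0] forces [u = mu^2 u'], then [eta_2 = 0]
    determines [v]. The free components [u'] and [v'] give the coefficients of [Xi] and [d_mubar].
    Holomorphy thus becomes linear algebra in the frame. *)
Lemma T01_Z_kernel (p : CC) (X : CT) :
  0 < 1 + kappa * Cmod (fst p) ^ 2 ->
  T01_Z (sigma_k kappa) p X <->
  eta (sigma_k kappa) p I1 X = RtoC 0 /\ eta (sigma_k kappa) p I2 X = RtoC 0.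
Proof.
  intros Hq. destruct p as [z m]. cbn [fst] in Hq.
  assert (He : RtoC (exp (sigma_k kappa z)) <> RtoC 0).
  { intros E. apply RtoC_inj in E. pose proof (exp_pos (sigma_k kappa z)). lra. }
  assert (He' : RtoC (exp (- sigma_k kappa z)) <> RtoC 0).
  { intros E. apply RtoC_inj in E. pose proof (exp_pos (- sigma_k kappa z)). lra. }
  unfold T01_Z, lin_comb, Xi, d_mubar, eta. cbn [fst snd dz1 dz1bar dz2 dz2bar].
  set (s := dz (sigma_k kappa) z). set (s' := dzbar (sigma_k kappa) z).
  split.
  - intros (a & b & ->). cbn [dz1 dz1bar dz2 dz2bar]. split; ring.
  - destruct X as [u u' v v']. cbn [dz1 dz1bar dz2 dz2bar]. intros [H1 H2].
    assert (Hu : u = (m * m * u')%C).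
    { apply Ceq_minus. rewrite <- (Cmult_1_l (_ - _)%C), <- (Cinv_l _ He).
      rewrite <- Cmult_assoc, H1. ring. }
    exists (u' / RtoC (exp (- sigma_k kappa z)))%C.
    exists (v' - u' * (m * m * s - s') * Cconj m)%C.
    f_equal.
    + rewrite Hu. field. auto.
    + field. auto.
    + replace v with ((v + m * (s * u - s' * u')) - m * (s * u - s' * u'))%C by ring.
      rewrite H2, Hu. field. auto.
    + field. auto.
Qed.

End Disc.

(** * The matrix of d beta and the lower bound for the pulled-back form *)

Lemma Cmult_conj_Cmod2 (z : C) : (z * Cconj z)%C = RtoC (Cmod z ^ 2).
Proof. rewrite <- Cmod2_conj, RtoC_pow. reflexivity. Qed.

Section Hermitian_estimate.

Variable kappa : R.
Hypothesis hkappa : -1 < kappa < 1.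

Lemma conf_ge (z : C) :
  Cmod z <= 1 -> 1 - Rabs kappa <= 1 + kappa * Cmod z ^ 2.
Proof.
  intros Hz. pose proof (Cmod_ge_0 z).
  pose proof (Rle_abs (- kappa)) as H1. rewrite Rabs_Ropp in H1.
  pose proof (Rabs_pos kappa). assert (0 <= Cmod z ^ 2 <= 1) by nra. nra.
Qed.

Lemma conf_pos (z : C) : Cmod z <= 1 -> 0 < 1 + kappa * Cmod z ^ 2.
Proof.
  intros Hz. pose proof (conf_ge z Hz).
  assert (Rabs kappa < 1) by (apply Rabs_def1; lra). lra.
Qed.

Lemma den_neq_0_Z (p : CC) : Defs.Z p -> den kappa (fst p) (snd p) <> RtoC 0.
Proof.
  intros [Hz Hm]. apply den_neq_0.
  assert (Rabs kappa < 1) by (apply Rabs_def1; lra).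
  pose proof (Rabs_pos kappa).
  pose proof (Cmod_ge_0 (fst p)). pose proof (Cmod_ge_0 (snd p)).
  assert (0 <= Cmod (fst p) * Cmod (snd p) <= 1) by nra.
  assert ((Cmod (fst p) * Cmod (snd p)) ^ 2 <= 1) by nra. nra.
Qed.

Lemma Z_int_Z (p : CC) : Z_int p -> Defs.Z p.
Proof. intros [Hz Hm]. split; lra. Qed.

(** The matrix of [d beta] in the frame [eta]. *)
Definition frame_matrix (p : CC) (l j : idx) : C :=
  let z := fst p in let m := snd p in
  (conf kappa z / (den kappa z m * den kappa z m) *
   match l, j with
   | I1, I2 => - (2 * (Cconj z * m))
   | I2, I1 => 2 * RtoC kappa * (Cconj z * m)
   | _, _ => 1 - RtoC kappa * (Cconj z * m) * (Cconj z * m)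
   end)%C.

Definition frame_map (p : CC) (xi : idx -> C) (l : idx) : C :=
  sum_idx (fun j => frame_matrix p l j * xi j)%C.

(** The inverse matrix is [/ conf] times entries of modulus at most 2, and [conf >= 1 - |kappa|].
    Hence each [(1 - |kappa|) |xi_j|] is at most [2 |Y1| + 2 |Y2|], whose square is at most
    [8 (|Y1|^2 + |Y2|^2)]; the two components together give 16. *)
Lemma frame_map_lower_bound (p : CC) (xi : idx -> C) :
  Defs.Z p ->
  (1 - Rabs kappa) ^ 2 / 16 * (Cmod (xi I1) ^ 2 + Cmod (xi I2) ^ 2)
    <= Cmod (frame_map p xi I1) ^ 2 + Cmod (frame_map p xi I2) ^ 2.
Proof.
  intros Hp. pose proof (den_neq_0_Z p Hp) as Hd. destruct Hp as [Hz Hm].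
  assert (Hk : Rabs kappa < 1) by (apply Rabs_def1; lra).
  pose proof (Rabs_pos kappa) as Hk0.
  pose proof (conf_ge _ Hz) as Hq.
  set (z := fst p) in *. set (m := snd p) in *.
  pose (a := (Cconj z * m)%C). pose (x := (1 - RtoC kappa * a * a)%C).
  set (Y1 := frame_map p xi I1). set (Y2 := frame_map p xi I2).
  assert (E1 : (conf kappa z * xi I1 = x * Y1 + 2 * a * Y2)%C).
  { unfold Y1, Y2, frame_map, sum_idx, frame_matrix, x, a. fold z m.
    unfold den in *. field. exact Hd. }
  assert (E2 : (conf kappa z * xi I2 = x * Y2 + (- (2 * RtoC kappa * a)) * Y1)%C).
  { unfold Y1, Y2, frame_map, sum_idx, frame_matrix, x, a. fold z m.
    unfold den in *. field. exact Hd. }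
  assert (Ha : Cmod a <= 1).
  { unfold a. rewrite Cmod_conj_mult.
    pose proof (Cmod_ge_0 z). pose proof (Cmod_ge_0 m). nra. }
  pose proof (Cmod_ge_0 a) as Ha0.
  assert (H2 : Cmod 2 = 2) by (rewrite Cmod_R, Rabs_pos_eq; lra).
  assert (Hx : Cmod x <= 2).
  { unfold x, Cminus. eapply Rle_trans; [apply Cmod_triangle|].
    rewrite Cmod_opp, !Cmod_mult, Cmod_1, Cmod_R. nra. }
  assert (H2a : Cmod (2 * a)%C <= 2) by (rewrite Cmod_mult, H2; lra).
  assert (H2ka : Cmod (- (2 * RtoC kappa * a))%C <= 2).
  { rewrite Cmod_opp, !Cmod_mult, H2, Cmod_R. nra. }
  assert (Hb : forall b c Y Y' X : C, Cmod b <= 2 -> Cmod c <= 2 ->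
    (conf kappa z * X = b * Y + c * Y')%C ->
    (1 - Rabs kappa) * Cmod X <= 2 * Cmod Y + 2 * Cmod Y').
  { intros b c Y Y' X Hb Hc E.
    apply Rle_trans with (Cmod (conf kappa z * X)%C).
    - rewrite Cmod_mult, <- conf_RtoC, Cmod_R,
        (Rabs_pos_eq (1 + kappa * Cmod z ^ 2)) by lra.
      apply Rmult_le_compat_r; [apply Cmod_ge_0|lra].
    - rewrite E. eapply Rle_trans; [apply Cmod_triangle|]. rewrite !Cmod_mult.
      apply Rplus_le_compat; apply Rmult_le_compat_r; auto using Cmod_ge_0. }
  pose proof (Hb _ _ _ _ _ Hx H2a E1) as B1.
  pose proof (Hb _ _ _ _ _ Hx H2ka E2) as B2.
  clearbody Y1 Y2. clear - B1 B2 Hk.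
  pose proof (Cmod_ge_0 Y1). pose proof (Cmod_ge_0 Y2).
  pose proof (Cmod_ge_0 (xi I1)). pose proof (Cmod_ge_0 (xi I2)).
  set (u := Cmod (xi I1)) in *. set (v := Cmod (xi I2)) in *.
  set (s := Cmod Y1) in *. set (t := Cmod Y2) in *. set (e := 1 - Rabs kappa) in *.
  assert (0 < e) by (unfold e; lra).
  assert (C1 : (e * u) ^ 2 <= (2 * s + 2 * t) ^ 2) by (apply pow_incr; split; [nra|lra]).
  assert (C2 : (e * v) ^ 2 <= (2 * t + 2 * s) ^ 2) by (apply pow_incr; split; [nra|lra]).
  clearbody u v s t e. pose proof (pow2_ge_0 (s - t)). simpl in *. nra.
Qed.

(** The factor [conf] of [frame_matrix] cancels the [/ conf] of [eta_e], which identifies the matrix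
    applied to the frame with [dbeta1] and [dbeta2]. *)
Lemma push_beta_frame (p : CC) (X : CT) :
  Defs.Z p ->
  let P := push (beta_k kappa) p in
  let M X := frame_map p (fun j => eta (sigma_k kappa) p j X) in
  dz1 (P X) = M X I1 /\ dz2 (P X) = M X I2 /\
  dz1bar (P X) = Cconj (M (conj_vec X) I1) /\
  dz2bar (P X) = Cconj (M (conj_vec X) I2).
Proof.
  intros Hp P M. pose proof (den_neq_0_Z p Hp) as Hd.
  pose proof (conf_pos _ (proj1 Hp)) as Hq.
  pose proof (conf_neq_0 kappa _ Hq) as Hq0.
  assert (HM : forall Y,
    M Y I1 = dbeta1 kappa (fst p) (snd p) (dz1 Y) (dz1bar Y) (dz2 Y) /\
    M Y I2 = dbeta2 kappa (fst p) (snd p) (dz1 Y) (dz1bar Y) (dz2 Y)).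
  { intros Y. unfold M, frame_map, sum_idx, frame_matrix, dbeta1, dbeta2.
    destruct (eta_e kappa p Y Hq) as [-> ->].
    generalize dependent (den kappa (fst p) (snd p)).
    generalize dependent (conf kappa (fst p)).
    intros; split; field; auto. }
  unfold P. rewrite push_beta by exact Hd. cbn [dz1 dz1bar dz2 dz2bar].
  rewrite (proj1 (HM X)), (proj2 (HM X)),
    (proj1 (HM (conj_vec X))), (proj2 (HM (conj_vec X))).
  repeat split; reflexivity.
Qed.

(** In the frame [eta] the pulled-back form is given by the Gram matrix of the columns of
    [frame_matrix]. Its quadratic form is the squared norm of [frame_map p xi], so that [herm_le] is
    the preceding estimate. *)
Lemma pullback_lower_bound (p : CC) :
  Defs.Z p ->
  form_le (eta (sigma_k kappa) p)
    (fun U V => (RtoC ((1 - Rabs kappa) ^ 2 / 16) * Omega_Z (sigma_k kappa) p U V)%C)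
    (pullback (beta_k kappa) p Omega_C2).
Proof.
  intros Hp. set (c := (1 - Rabs kappa) ^ 2 / 16).
  set (N := frame_matrix p).
  exists (fun j k => match j, k with
                     | I1, I1 | I2, I2 => RtoC c | _, _ => RtoC 0 end).
  exists (fun j k => sum_idx (fun l => N l j * Cconj (N l k))%C).
  assert (Hc : Cconj (RtoC c) = RtoC c)
    by (apply injective_projections; simpl; ring).
  assert (H0 : Cconj (RtoC 0) = RtoC 0)
    by (apply injective_projections; simpl; ring).
  split; [split|split; [split|]].
  - intros [] []; auto.
  - intros U V. unfold Omega_Z, sum_form, hermitian_form, sum_idx. ring.
  - intros j k. unfold sum_idx.
    rewrite Cplus_conj, !Cmult_conj, !Cconj_conj. ring.
  - intros U V. unfold pullback, Omega_C2, sum_form, wedge at 1 2, conj_form at 1 2 3 4.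
    unfold conj_vec at 1 2 3 4. cbn [dz1 dz2].
    destruct (push_beta_frame p U Hp) as (-> & -> & -> & ->).
    destruct (push_beta_frame p V Hp) as (-> & -> & -> & ->).
    unfold hermitian_form, sum_idx, wedge, conj_form, frame_map, sum_idx.
    fold N. rewrite !Cconj_conj, !Cplus_conj, !Cmult_conj. ring.
  - intros xi.
    pose proof (frame_map_lower_bound p xi Hp) as H. fold c in H.
    replace (sum_idx _) with
      (RtoC (Cmod (frame_map p xi I1) ^ 2 + Cmod (frame_map p xi I2) ^ 2
        - c * (Cmod (xi I1) ^ 2 + Cmod (xi I2) ^ 2))).
    + simpl. simpl in H. lra.
    + rewrite RtoC_minus, RtoC_mult, !RtoC_plus, <- !Cmult_conj_Cmod2.
      unfold frame_map, sum_idx. fold N.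
      rewrite !Cplus_conj, !Cmult_conj. ring.
Qed.

End Hermitian_estimate.

(** * Smoothness and holomorphy of beta *)

Lemma open_positive {V : NormedModule R_AbsRing} (U : V -> Prop) (f : V -> R) :
  open U -> smooth_on (W := R_NormedModule) U f -> open (fun p => U p /\ 0 < f p).
Proof.
  intros HU Hf p [Hp H0]. apply filter_and; [now apply HU|].
  assert (Hc := smooth_on_continuous U (W := R_NormedModule) f p Hf Hp).
  apply (Hc (fun y => 0 < y)). now apply open_gt.
Qed.

Lemma smooth_on_sub {V W : NormedModule R_AbsRing} (U U' : V -> Prop) (f : V -> W) :
  (forall p, U' p -> U p) -> smooth_on U f -> smooth_on U' f.
Proof. intros Hs Hf k. now apply Ck_on_sub with U. Qed.

Lemma smooth_on_ext {V W : NormedModule R_AbsRing} (U : V -> Prop) (f g : V -> W) :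
  open U -> (forall p, U p -> f p = g p) -> smooth_on U f -> smooth_on U g.
Proof. intros HU Hfg Hf k. now apply Ck_on_ext with f. Qed.

Lemma smooth_on_fst (U : CC -> Prop) : smooth_on (W := CR) U fst.
Proof. apply (smooth_on_linear (W := CR)), is_linear_fst. Qed.

Lemma smooth_on_snd (U : CC -> Prop) : smooth_on (W := CR) U snd.
Proof. apply (smooth_on_linear (W := CR)), is_linear_snd. Qed.

Lemma smooth_on_derive {V W : NormedModule R_AbsRing} (U : V -> Prop) (f : V -> W)
    (p v : V) :
  smooth_on U f -> U p ->
  exists l, is_derive (fun t : R => f (plus p (scal t v))) 0 l.
Proof.
  intros Hf Hp. destruct (Hf 1%nat) as [_ Hd], (Hd v) as [g [Hg _]].
  exists (g p); auto.
Qed.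

Ltac smooth :=
  lazymatch goal with
  | |- smooth_on _ fst => apply smooth_on_fst
  | |- smooth_on _ snd => apply smooth_on_snd
  | |- smooth_on _ (fun _ => (_ + _)%C) => apply smooth_on_Cplus; smooth
  | |- smooth_on _ (fun _ => (_ - _)%C) => apply smooth_on_Cminus; smooth
  | |- smooth_on _ (fun _ => (_ * _)%C) => apply smooth_on_Cmult; smooth
  | |- smooth_on _ (fun _ => (_ / _)%C) => apply smooth_on_Cdiv; [|smooth|smooth]
  | |- smooth_on _ (fun _ => Cconj _) => apply smooth_on_Cconj; smooth
  | |- _ => first [assumption | apply smooth_on_const | idtac]
  end.

Section Beta_smooth.

Variable kappa : R.

Definition den_domain (p : CC) : Prop := den kappa (fst p) (snd p) <> RtoC 0.

Lemma smooth_on_den (U : CC -> Prop) :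
  smooth_on (W := CR) U (fun p => den kappa (fst p) (snd p)).
Proof. unfold den. smooth. Qed.

Lemma open_den_domain : open den_domain.
Proof.
  apply open_ext with
    (fun p : CC => True /\ 0 < Cmod (den kappa (fst p) (snd p)) ^ 2).
  - intros p. unfold den_domain. rewrite Cmod_gt_0.
    pose proof (Cmod_ge_0 (den kappa (fst p) (snd p))). split; [|split]; auto.
    + intros [_ H1]. nra.
    + nra.
  - apply (open_positive (fun _ : CC => True)); [apply open_true|].
    apply smooth_on_Cmod2; [apply open_true|apply smooth_on_den].
Qed.

Lemma smooth_on_conf (U : CC -> Prop) :
  smooth_on (W := CR) U (fun p => conf kappa (fst p)).
Proof. unfold conf. smooth. Qed.

Lemma smooth_on_beta : smooth_on den_domain (beta_k kappa).
Proof.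
  apply smooth_on_ext with (fun p : CC =>
    (((fst p - snd p * snd p * Cconj (fst p)) / den kappa (fst p) (snd p))%C,
     (snd p * (conf kappa (fst p) / den kappa (fst p) (snd p)))%C)).
  - apply open_den_domain.
  - intros p _. unfold beta_k. cbv zeta. now rewrite conf_RtoC.
  - apply (smooth_on_pair (W := CR) (W' := CR)).
    + smooth; auto. apply smooth_on_den.
    + apply smooth_on_Cmult; [smooth|].
      apply smooth_on_Cdiv; auto using smooth_on_conf, smooth_on_den.
Qed.

Hypothesis hkappa : -1 < kappa < 1.

Lemma smooth_near_beta : smooth_near Defs.Z (beta_k kappa).
Proof.
  exists den_domain, (beta_k kappa). split; [apply open_den_domain|].
  split; [|split; [apply smooth_on_beta|auto]].
  intros p Hp. now apply den_neq_0_Z.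
Qed.

Lemma holomorphic_on_beta :
  holomorphic_on Z_int (T01_Z (sigma_k kappa)) T01_C2 (beta_k kappa).
Proof.
  split.
  - apply smooth_on_sub with den_domain; [|apply smooth_on_beta].
    intros p Hp. apply den_neq_0_Z; auto. now apply Z_int_Z.
  - intros p X Hp HX. apply Z_int_Z in Hp.
    apply (T01_Z_kernel kappa p X (conf_pos kappa hkappa _ (proj1 Hp))) in HX.
    destruct HX as [H1 H2].
    destruct (push_beta_frame kappa hkappa p X Hp) as (E1 & E2 & _).
    split; [rewrite E1|rewrite E2]; unfold frame_map, sum_idx;
      rewrite H1, H2; ring.
Qed.

End Beta_smooth.

(** * Formulas for the inverse and the open set on which they are smooth *)

Section Inverse.

Variable kappa : R.
Hypothesis hkappa : -1 < kappa < 1.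

(** With [Q = xi^2 + kappa w^2], the equation [beta (z, mu) = (w, xi)] implies
    [z - Q conj z = (1 - kappa |z|^2) w]; hence [z = (1 - kappa |z|^2) P], and
    taking absolute values gives a quadratic equation for [1 - kappa |z|^2]. *)
Definition inv_Q (q : CC) : C := (snd q * snd q + RtoC kappa * (fst q * fst q))%C.

(** The solution of [P - Q conj P = w], obtained by eliminating [conj P] with the conjugate
    equation. *)
Definition inv_P (q : CC) : C :=
  ((fst q + inv_Q q * Cconj (fst q)) / (1 - inv_Q q * Cconj (inv_Q q)))%C.

Definition inv_S (q : CC) : R := 1 + 4 * kappa * Cmod (inv_P q) ^ 2.

(** A root of [kappa |P|^2 y^2 + y - 1 = 0], the equation of [y = 1 - kappa |z|^2]. In this
    rationalised form it needs no case distinction when [kappa |P|^2 = 0]. *)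
Definition inv_y (q : CC) : R := 2 * / (1 + sqrt (inv_S q)).

Definition inv_z (q : CC) : C := (RtoC (inv_y q) * inv_P q)%C.

(** At [(w, xi) = beta (z, mu)] this is [conf / den], the factor by which [xi] differs from [mu]. *)
Definition inv_h (q : CC) : C := (1 + RtoC kappa * (Cconj (inv_z q) * fst q))%C.

Definition inv_mu (q : CC) : C := (snd q / inv_h q)%C.

Definition beta_inv (q : CC) : CC := (inv_z q, inv_mu q).

(** The conditions are added one at a time, starting from the whole space, in the form required by
    [open_positive]. Those on [Q], [S] and [h] make the formulas smooth, those on [z] and [mu] put
    the result into [Z_int]. Together they describe the image of [beta] exactly, by [image_beta]. *)
Definition dom_Q (q : CC) : Prop := True /\ 0 < 1 - Cmod (inv_Q q) ^ 2.
Definition dom_S (q : CC) : Prop := dom_Q q /\ 0 < inv_S q.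
Definition dom_z (q : CC) : Prop := dom_S q /\ 0 < 1 - Cmod (inv_z q) ^ 2.
Definition dom_h (q : CC) : Prop := dom_z q /\ 0 < Cmod (inv_h q) ^ 2.
Definition dom_mu (q : CC) : Prop := dom_h q /\ 0 < 1 - Cmod (inv_mu q) ^ 2.

Lemma inv_P_den (q : CC) :
  dom_Q q -> (1 - inv_Q q * Cconj (inv_Q q))%C <> RtoC 0.
Proof.
  intros [_ H] E. rewrite Cmult_conj_Cmod2, <- RtoC_minus in E.
  apply RtoC_inj in E. lra.
Qed.

Lemma inv_domain_smooth :
  open dom_mu /\ smooth_on dom_mu beta_inv.
Proof.
  assert (HQ : forall U, smooth_on (W := CR) U inv_Q)
    by (intros U; unfold inv_Q; smooth).
  assert (oQ : open dom_Q).
  { apply (open_positive (fun _ => True) (fun q => 1 - Cmod (inv_Q q) ^ 2));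
      [apply open_true|].
    apply smooth_on_Rminus; [apply (smooth_on_const (W := R_NormedModule))|].
    apply smooth_on_Cmod2; auto. apply open_true. }
  assert (HP : smooth_on (W := CR) dom_Q inv_P).
  { unfold inv_P. smooth; try apply HQ. exact inv_P_den. }
  assert (HS : smooth_on (W := R_NormedModule) dom_Q inv_S).
  { unfold inv_S. apply smooth_on_Rplus;
      [apply (smooth_on_const (W := R_NormedModule))|].
    apply smooth_on_Rmult; [apply (smooth_on_const (W := R_NormedModule))|].
    apply smooth_on_Cmod2; auto. }
  assert (oS : open dom_S) by (apply open_positive; auto).
  assert (Hz : smooth_on (W := CR) dom_S inv_z).
  { unfold inv_z. apply smooth_on_Cmult.
    - apply smooth_on_RtoC. unfold inv_y.
      apply smooth_on_Rmult; [apply (smooth_on_const (W := R_NormedModule))|].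
      apply smooth_on_Rinv.
      + intros q Hq. pose proof (sqrt_pos (inv_S q)). lra.
      + apply smooth_on_Rplus; [apply (smooth_on_const (W := R_NormedModule))|].
        apply smooth_on_sqrt; [now intros q []|].
        apply smooth_on_sub with dom_Q; auto. now intros q [].
    - apply smooth_on_sub with dom_Q; auto. now intros q []. }
  assert (oz : open dom_z).
  { apply (open_positive dom_S (fun q => 1 - Cmod (inv_z q) ^ 2)); auto.
    apply smooth_on_Rminus; [apply (smooth_on_const (W := R_NormedModule))|].
    apply smooth_on_Cmod2; auto. }
  assert (Hh : smooth_on (W := CR) dom_S inv_h).
  { unfold inv_h. smooth. }
  assert (oh : open dom_h).
  { apply (open_positive dom_z (fun q => Cmod (inv_h q) ^ 2)); auto.
    apply smooth_on_Cmod2; auto.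
    apply smooth_on_sub with dom_S; auto. now intros q []. }
  assert (Hmu : smooth_on (W := CR) dom_h inv_mu).
  { unfold inv_mu. smooth.
    - intros q [_ H] E. rewrite E, Cmod_0 in H. lra.
    - apply smooth_on_sub with dom_S; auto. now intros q [[? _] _]. }
  split.
  - apply (open_positive dom_h (fun q => 1 - Cmod (inv_mu q) ^ 2)); auto.
    apply smooth_on_Rminus; [apply (smooth_on_const (W := R_NormedModule))|].
    apply smooth_on_Cmod2; auto.
  - apply (smooth_on_pair (W := CR) (W' := CR)).
    + apply smooth_on_sub with dom_S; auto. now intros q [[[? _] _] _].
    + apply smooth_on_sub with dom_h; auto. now intros q [].
Qed.

End Inverse.

(** * The inverse of beta *)

Lemma RtoC_conj (x : R) : Cconj (RtoC x) = RtoC x.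
Proof. apply injective_projections; simpl; ring. Qed.

Lemma beta_k_eq (kappa : R) (p : CC) :
  beta_k kappa p =
  (((fst p - snd p * snd p * Cconj (fst p)) / den kappa (fst p) (snd p))%C,
   (snd p * (conf kappa (fst p) / den kappa (fst p) (snd p)))%C).
Proof. unfold beta_k. cbv zeta. now rewrite conf_RtoC. Qed.

Lemma den_conj (kappa : R) (z m : C) :
  Cconj (den kappa z m) = (1 + RtoC kappa * (z * z) * (Cconj m * Cconj m))%C.
Proof.
  unfold den. rewrite Cplus_conj, !Cmult_conj, !Cconj_conj, !RtoC_conj. ring.
Qed.

Lemma RtoC_neq_0 (x : R) : x <> 0 -> RtoC x <> RtoC 0.
Proof. intros Hx H. apply Hx. now apply RtoC_inj. Qed.

Section Inverse.

Variable kappa : R.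
Hypothesis hkappa : -1 < kappa < 1.

(** * Recovering a point of the interior from its image *)

Section Left_inverse.

Variable p : CC.
Hypothesis hp : Z_int p.

Let z : C := fst p.
Let m : C := snd p.
Let s : R := kappa * Cmod z ^ 2.

Lemma Cmod2_lt_1 (c : C) : Cmod c < 1 -> 0 <= Cmod c ^ 2 < 1.
Proof. intros H. pose proof (Cmod_ge_0 c). nra. Qed.

Lemma s_bound : -1 < s < 1.
Proof.
  pose proof (Cmod2_lt_1 z (proj1 hp)). unfold s. nra.
Qed.

(** In [xi^2 + kappa w^2] the cross terms [2 kappa mu^2 |z|^2] have opposite signs and cancel; what
    remains contains one factor [den] of the denominator [den^2]. *)
Lemma inv_Q_beta :
  inv_Q kappa (beta_k kappa p)
    = ((m * m + RtoC kappa * (z * z)) / den kappa z m)%C.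
Proof.
  pose proof (den_neq_0_Z kappa hkappa p (Z_int_Z p hp)) as Hd.
  rewrite beta_k_eq. unfold inv_Q; cbn [fst snd]. fold z m in Hd |- *.
  unfold conf, den in *. field. exact Hd.
Qed.

(** [|1 + conj A B|^2 - |A + B|^2 = (1 - |A|^2) (1 - |B|^2)] with
    [A = kappa z^2] and [B = mu^2]. *)
Lemma inv_Q_norm :
  Cmod (den kappa z m) ^ 2 - Cmod (m * m + RtoC kappa * (z * z))%C ^ 2
    = (1 - (Cmod m ^ 2) ^ 2) * (1 - s ^ 2).
Proof.
  apply RtoC_inj. unfold s.
  rewrite RtoC_minus, RtoC_mult, !RtoC_minus, (RtoC_pow (Cmod m ^ 2)),
    (RtoC_pow (kappa * _)), RtoC_mult, <- !Cmult_conj_Cmod2, den_conj.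
  rewrite Cplus_conj, !Cmult_conj, RtoC_conj. unfold den.
  simpl. ring.
Qed.

Lemma dom_Q_beta : dom_Q kappa (beta_k kappa p).
Proof.
  pose proof (den_neq_0_Z kappa hkappa p (Z_int_Z p hp)) as Hd.
  fold z m in Hd. split; [exact I|].
  rewrite inv_Q_beta, Cmod_div by exact Hd.
  apply Cmod_gt_0 in Hd. pose proof inv_Q_norm as H. pose proof s_bound.
  pose proof (Cmod2_lt_1 m (proj2 hp)).
  assert (0 < (1 - (Cmod m ^ 2) ^ 2) * (1 - s ^ 2)).
  { apply Rmult_lt_0_compat; nra. }
  replace (1 - _) with
    ((Cmod (den kappa z m) ^ 2 - Cmod (m * m + RtoC kappa * (z * z)) ^ 2)
     / Cmod (den kappa z m) ^ 2) by (field; lra).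
  apply Rdiv_lt_0_compat; [lra|]. nra.
Qed.

Lemma inv_P_beta : inv_P kappa (beta_k kappa p) = (RtoC (/ (1 - s)) * z)%C.
Proof.
  pose proof (den_neq_0_Z kappa hkappa p (Z_int_Z p hp)) as Hd.
  fold z m in Hd.
  pose proof (inv_P_den kappa _ dom_Q_beta) as HQ.
  pose proof s_bound.
  assert (Hs : (1 - RtoC kappa * (z * Cconj z))%C = RtoC (1 - s)).
  { unfold s. rewrite RtoC_minus, RtoC_mult, <- Cmult_conj_Cmod2. reflexivity. }
  assert (Hs0 : (1 - RtoC kappa * (z * Cconj z))%C <> RtoC 0).
  { rewrite Hs. apply RtoC_neq_0. lra. }
  assert (Hd' : Cconj (den kappa z m) <> RtoC 0).
  { intros E. apply Hd. rewrite <- (Cconj_conj (den _ _ _)), E, RtoC_conj.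
    reflexivity. }
  rewrite RtoC_inv, <- Hs by lra. unfold inv_P.
  rewrite inv_Q_beta in *. rewrite beta_k_eq. cbn [fst snd]. fold z m.
  rewrite !Cdiv_conj, Cminus_conj, Cplus_conj, !Cmult_conj, RtoC_conj,
    Cconj_conj in * by exact Hd.
  rewrite den_conj in *. unfold den in *.
  (* With the conjugates as independent variables the claim is an identity of rational functions. *)
  generalize dependent (Cconj z). generalize dependent (Cconj m). intros m' z'; intros.
  field. repeat split; auto.
  (* The side condition left by [field] concerns the numerator of [1 - |Q|^2]. *)
  intros E. apply HQ.
  replace (1 - _)%C with
    (((1 + RtoC kappa * (c * c) * (m * m)) * (1 + RtoC kappa * (z * z) * (m' * m'))
      - (m * m + RtoC kappa * (z * z)) * (m' * m' + RtoC kappa * (c * c)))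
     / ((1 + RtoC kappa * (c * c) * (m * m))
        * (1 + RtoC kappa * (z * z) * (m' * m'))))%C by (field; auto).
  rewrite E. unfold Cdiv. ring.
Qed.

(** [1 + 4 s / (1 - s)^2] is a perfect square, and [|s| < 1] makes its positive root
    [(1 + s) / (1 - s)]. The sign of the root in [inv_y] is therefore the right one. *)
Lemma inv_S_beta : inv_S kappa (beta_k kappa p) = ((1 + s) / (1 - s)) ^ 2.
Proof.
  pose proof s_bound. unfold inv_S.
  rewrite inv_P_beta, Cmod_mult, Cmod_R, Rabs_pos_eq
    by (left; apply Rinv_0_lt_compat; lra).
  unfold s in *. field. lra.
Qed.

Lemma inv_y_beta : inv_y kappa (beta_k kappa p) = 1 - s.
Proof.
  pose proof s_bound. unfold inv_y. rewrite inv_S_beta, sqrt_pow2.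
  - field. lra.
  - left. apply Rdiv_lt_0_compat; lra.
Qed.

Lemma inv_z_beta : inv_z kappa (beta_k kappa p) = z.
Proof.
  pose proof s_bound. unfold inv_z.
  rewrite inv_y_beta, inv_P_beta, RtoC_inv by lra. field. apply RtoC_neq_0; lra.
Qed.

Lemma inv_h_beta :
  inv_h kappa (beta_k kappa p) = (conf kappa z / den kappa z m)%C.
Proof.
  pose proof (den_neq_0_Z kappa hkappa p (Z_int_Z p hp)) as Hd.
  unfold inv_h. rewrite inv_z_beta, beta_k_eq. cbn [fst snd]. fold z m in Hd |- *.
  unfold conf, den in *. field. exact Hd.
Qed.

Lemma inv_h_beta_neq_0 : inv_h kappa (beta_k kappa p) <> RtoC 0.
Proof.
  rewrite inv_h_beta. apply Cmult_neq_0.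
  - apply conf_neq_0, conf_pos; auto. now apply (Z_int_Z p hp).
  - intros E. apply C1_nz.
    rewrite <- (Cinv_r (den kappa z m)), E; [ring|].
    apply (den_neq_0_Z kappa hkappa p (Z_int_Z p hp)).
Qed.

Lemma inv_mu_beta : inv_mu kappa (beta_k kappa p) = m.
Proof.
  unfold inv_mu. pose proof inv_h_beta_neq_0 as H. rewrite inv_h_beta in *.
  rewrite beta_k_eq. cbn [snd]. fold z m. field.
  pose proof (den_neq_0_Z kappa hkappa p (Z_int_Z p hp)) as Hd. fold z m in Hd.
  split; [exact Hd|]. apply conf_neq_0, conf_pos; auto. now apply (Z_int_Z p hp).
Qed.

Lemma beta_inv_beta : beta_inv kappa (beta_k kappa p) = p.
Proof. unfold beta_inv. rewrite inv_z_beta, inv_mu_beta. now destruct p. Qed.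

Lemma dom_mu_beta : dom_mu kappa (beta_k kappa p).
Proof.
  pose proof s_bound.
  split; [split; [split; [split; [apply dom_Q_beta|]|]|]|].
  - rewrite inv_S_beta. apply pow_lt, Rdiv_lt_0_compat; lra.
  - rewrite inv_z_beta. pose proof (Cmod2_lt_1 z (proj1 hp)). lra.
  - apply pow_lt, Cmod_gt_0, inv_h_beta_neq_0.
  - rewrite inv_mu_beta. pose proof (Cmod2_lt_1 m (proj2 hp)). lra.
Qed.

End Left_inverse.

(** * Points satisfying the inequalities are images *)

Section Right_inverse.

Variable q : CC.
Hypothesis hq : dom_mu kappa q.

Let z : C := inv_z kappa q.
Let m : C := inv_mu kappa q.

Lemma beta_inv_Z_int : Z_int (beta_inv kappa q).
Proof.
  destruct hq as [[[_ Hz] _] Hm]. unfold Z_int, beta_inv; cbn [fst snd].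
  pose proof (Cmod_ge_0 (inv_z kappa q)). pose proof (Cmod_ge_0 (inv_mu kappa q)).
  split; nra.
Qed.

(** With [t = sqrt S], [kappa |z|^2 = (t^2 - 1) / (1 + t)^2 = (t - 1) / (t + 1)], and subtracting
    this from 1 leaves [2 / (1 + t)]. *)
Lemma inv_y_eq : inv_y kappa q = 1 - kappa * Cmod z ^ 2.
Proof.
  destruct hq as [[[[_ HS] _] _] _].
  unfold z, inv_z. rewrite Cmod_mult, Cmod_R, Rpow_mult_distr, pow2_abs.
  pose proof (sqrt_pos (inv_S kappa q)) as Ht.
  pose proof (sqrt_sqrt _ (Rlt_le _ _ HS)) as E.
  unfold inv_y. set (t := sqrt (inv_S kappa q)) in *.
  unfold inv_S in E.
  replace (kappa * _) with ((/ (1 + t)) ^ 2 * (4 * kappa * Cmod (inv_P kappa q) ^ 2))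
    by (simpl; field; lra).
  replace (4 * kappa * _) with (t * t - 1) by lra. field. lra.
Qed.

(** The equation [P - Q conj P = w] is real-linear in [P], so it can be multiplied by the real
    number [y], which [inv_y_eq] expresses through [z]. *)
Lemma inv_z_eq :
  (z - inv_Q kappa q * Cconj z)%C = (fst q * (1 - RtoC kappa * (z * Cconj z)))%C.
Proof.
  assert (HP : (inv_P kappa q - inv_Q kappa q * Cconj (inv_P kappa q))%C = fst q).
  { assert (H0 := inv_P_den kappa q (proj1 (proj1 (proj1 (proj1 hq))))).
    assert (H0' : Cconj (1 - inv_Q kappa q * Cconj (inv_Q kappa q))%C
      = (1 - inv_Q kappa q * Cconj (inv_Q kappa q))%C).
    { rewrite Cminus_conj, Cmult_conj, Cconj_conj, RtoC_conj. ring. }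
    unfold inv_P. rewrite Cdiv_conj, H0', Cplus_conj, Cmult_conj, Cconj_conj by auto.
    field. exact H0. }
  transitivity (RtoC (inv_y kappa q) * fst q)%C.
  - rewrite <- HP. unfold z, inv_z. rewrite Cmult_conj, RtoC_conj. ring.
  - rewrite inv_y_eq, RtoC_minus, RtoC_mult, <- Cmult_conj_Cmod2. ring.
Qed.

(** The equation for [z] rearranges to [conj z xi^2 = (z - w) h]. Dividing by [h^2] gives
    [mu^2 conj z = (z - w) / h], and with it [den = conf / h]; both components follow. *)
Lemma beta_beta_inv : beta_k kappa (beta_inv kappa q) = q.
Proof.
  pose proof (den_neq_0_Z kappa hkappa _ (Z_int_Z _ beta_inv_Z_int)) as Hd.
  pose proof inv_z_eq as E. rewrite beta_k_eq.
  unfold beta_inv in *. cbn [fst snd] in *. fold z m in Hd |- *.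
  assert (Hh : inv_h kappa q <> RtoC 0).
  { destruct hq as [[_ H] _]. intros E'. rewrite E', Cmod_0 in H. lra. }
  assert (Eh : inv_h kappa q = (1 + RtoC kappa * (Cconj z * fst q))%C)
    by reflexivity.
  assert (Em : m = (snd q / inv_h kappa q)%C) by reflexivity.
  set (h := inv_h kappa q) in *. clearbody h m.
  unfold inv_Q in E. destruct q as [w xi]. cbn [fst snd] in *.
  change C in w. change C in xi.
  assert (Ezx : (Cconj z * (xi * xi))%C = ((z - w) * h)%C).
  { rewrite Eh. apply Ceq_minus in E. apply Ceq_minus.
    replace (_ - _)%C with
     (- (z - (xi * xi + RtoC kappa * (w * w)) * Cconj z
         - w * (1 - RtoC kappa * (z * Cconj z))))%C by ring.
    rewrite E. ring. }
  assert (Ezm : (m * m * Cconj z)%C = ((z - w) / h)%C).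
  { rewrite Em. replace (_ * _ * _)%C with (Cconj z * (xi * xi) / (h * h))%C
      by (field; exact Hh).
    rewrite Ezx. field. exact Hh. }
  assert (Ed : den kappa z m = (conf kappa z / h)%C).
  { unfold den.
    replace (_ * (Cconj z * Cconj z) * _)%C
      with (RtoC kappa * Cconj z * (m * m * Cconj z))%C by ring.
    rewrite Ezm. unfold conf. rewrite Eh in *. field. exact Hh. }
  rewrite Ed in *.
  assert (Hc : conf kappa z <> RtoC 0).
  { intros E0. apply Hd. rewrite E0. unfold Cdiv. ring. }
  rewrite Ezm, Em. apply injective_projections; cbn [fst snd];
    match goal with |- ?a = ?b => change (@eq C a b) end.
  - rewrite Eh in *. unfold conf in *. field. auto.
  - field. auto.
Qed.

End Right_inverse.

(** Openness of the image is read off from this description by strict inequalities. *)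
Lemma image_beta (q : CC) : image Z_int (beta_k kappa) q <-> dom_mu kappa q.
Proof.
  split.
  - intros (p & Hp & <-). now apply dom_mu_beta.
  - intros Hq. exists (beta_inv kappa q).
    split; [now apply beta_inv_Z_int|now apply beta_beta_inv].
Qed.

(** Differentiating [beta o beta_inv = id] in the direction [v] shows that [dbeta1] and [dbeta2] of
    the velocity of [beta_inv] are the components of [v]; [dbeta_inv] solves for [e1] and [e2]. The
    right sides are complex-linear in [v]. *)
Lemma e_beta_inv (q v : CC) :
  dom_mu kappa q ->
  let z := inv_z kappa q in
  let m := inv_mu kappa q in
  let u := dir_deriv (inv_z kappa) q v in
  let x := (1 - RtoC kappa * (Cconj z * m) * (Cconj z * m))%C in
  e1 m u (Cconj u) = (x * fst v + 2 * (Cconj z * m) * snd v)%C /\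
  e2 kappa z m u (Cconj u) (dir_deriv (inv_mu kappa) q v)
    = (x * snd v - 2 * RtoC kappa * (Cconj z * m) * fst v)%C.
Proof.
  intros Hq z m u x. destruct (inv_domain_smooth kappa) as [Ho Hs].
  destruct (smooth_on_derive _ _ q v Hs Hq) as [[a b] Hl].
  assert (Ha : is_derive (V := CR)
                 (fun t : R => inv_z kappa (plus q (scal t v))) 0 a).
  { apply (is_derive_linear (W := CC) (W' := CR) fst
      (fun t => beta_inv kappa (plus q (scal t v))) 0 (a, b)); auto.
    apply is_linear_fst. }
  assert (Hb : is_derive (V := CR)
                 (fun t : R => inv_mu kappa (plus q (scal t v))) 0 b).
  { apply (is_derive_linear (W := CC) (W' := CR) snd
      (fun t => beta_inv kappa (plus q (scal t v))) 0 (a, b)); auto.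
    apply is_linear_snd. }
  assert (Eu : u = a) by now apply is_Cderive_unique.
  assert (Ev : dir_deriv (inv_mu kappa) q v = b) by now apply is_Cderive_unique.
  rewrite Eu, Ev.
  pose proof (den_neq_0_Z kappa hkappa _ (Z_int_Z _ (beta_inv_Z_int q Hq))) as Hd.
  assert (HB := is_Cderive_beta kappa _ _ 0 a b Ha Hb). cbv beta in HB.
  rewrite line_0 in HB. destruct (HB Hd) as [H1 H2].
  assert (Hloc : locally 0 (fun t : R => dom_mu kappa (plus q (scal t v))))
    by now apply locally_line.
  assert (F1 : dbeta1 kappa z m a (Cconj a) b = fst v).
  { apply is_Cderive_unique in H1. unfold z, m. rewrite <- H1.
    apply (is_Cderive_unique
      (fun t => fst (beta_k kappa (beta_inv kappa (plus q (scal t v)))))).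
    apply is_derive_ext_loc with (fun t : R => fst (plus q (scal t v))).
    - eapply filter_imp; [|exact Hloc]. intros t Ht. cbv beta.
      now rewrite beta_beta_inv.
    - apply (is_derive_line (V := CC) (W := CR) fst), is_linear_fst. }
  assert (F2 : dbeta2 kappa z m a (Cconj a) b = snd v).
  { apply is_Cderive_unique in H2. unfold z, m. rewrite <- H2.
    apply (is_Cderive_unique
      (fun t => snd (beta_k kappa (beta_inv kappa (plus q (scal t v)))))).
    apply is_derive_ext_loc with (fun t : R => snd (plus q (scal t v))).
    - eapply filter_imp; [|exact Hloc]. intros t Ht. cbv beta.
      now rewrite beta_beta_inv.
    - apply (is_derive_line (V := CC) (W := CR) snd), is_linear_snd. }
  destruct (dbeta_inv kappa z m a (Cconj a) b Hd) as [G1 G2].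
  rewrite F1, F2 in G1, G2. auto.
Qed.

(** By complex linearity in [e_beta_inv], the direction 1 plus i times the direction i, the
    combination in [d1bar] and [d2bar], contributes the factor [1 + i * i = 0] to [e1] and [e2]. *)
Lemma holomorphic_on_beta_inv :
  holomorphic_on (image Z_int (beta_k kappa)) T01_C2 (T01_Z (sigma_k kappa))
    (beta_inv kappa).
Proof.
  destruct (inv_domain_smooth kappa) as [Ho Hs]. split.
  { apply smooth_on_sub with (dom_mu kappa); auto.
    intros q. apply image_beta. }
  intros q X Hq [HX1 HX2]. apply image_beta in Hq.
  pose proof (beta_inv_Z_int q Hq) as [Hz _].
  assert (Hc : 0 < 1 + kappa * Cmod (fst (beta_inv kappa q)) ^ 2)
    by (apply conf_pos; auto; lra).
  apply T01_Z_kernel; auto.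
  rewrite (proj1 (eta_e kappa _ _ Hc)), (proj2 (eta_e kappa _ _ Hc)).
  enough (H : e1 (inv_mu kappa q) (dz1 (push (beta_inv kappa) q X))
                (dz1bar (push (beta_inv kappa) q X)) = RtoC 0 /\
              e2 kappa (inv_z kappa q) (inv_mu kappa q)
                (dz1 (push (beta_inv kappa) q X))
                (dz1bar (push (beta_inv kappa) q X))
                (dz2 (push (beta_inv kappa) q X)) = RtoC 0).
  { change (inv_z kappa q) with (fst (beta_inv kappa q)) in H.
    change (inv_mu kappa q) with (snd (beta_inv kappa q)) in H.
    destruct H as [-> ->]. unfold Cdiv; split; ring. }
  pose proof (e_beta_inv q (RtoC 1, RtoC 0) Hq) as [A1 A2].
  pose proof (e_beta_inv q (Ci, RtoC 0) Hq) as [B1 B2].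
  pose proof (e_beta_inv q (RtoC 0, RtoC 1) Hq) as [C1 C2].
  pose proof (e_beta_inv q (RtoC 0, Ci) Hq) as [D1 D2].
  cbv zeta in *. cbn [push dz1 dz1bar dz2]. unfold act, d1bar, d2bar.
  rewrite HX1, HX2.
  change (fun q0 => fst (beta_inv kappa q0)) with (inv_z kappa).
  change (fun q0 => snd (beta_inv kappa q0)) with (inv_mu kappa).
  change (fun q0 => Cconj (fst (beta_inv kappa q0)))
    with (fun q0 => Cconj (inv_z kappa q0)).
  rewrite !dir_deriv_conj. cbn [fst snd] in *.
  assert (HCi : (1 + Ci * Ci = 0)%C) by (apply injective_projections; simpl; ring).
  set (x := (1 - _)%C) in *. set (y := (2 * (_ * _))%C) in *.
  set (y' := (2 * _ * _)%C) in *.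
  set (z := inv_z kappa q) in *. set (m := inv_mu kappa q) in *.
  set (zA := dir_deriv (inv_z kappa) q (RtoC 1, RtoC 0)) in *.
  set (zB := dir_deriv (inv_z kappa) q (Ci, RtoC 0)) in *.
  set (zC := dir_deriv (inv_z kappa) q (RtoC 0, RtoC 1)) in *.
  set (zD := dir_deriv (inv_z kappa) q (RtoC 0, Ci)) in *.
  set (mA := dir_deriv (inv_mu kappa) q (RtoC 1, RtoC 0)) in *.
  set (mB := dir_deriv (inv_mu kappa) q (Ci, RtoC 0)) in *.
  set (mC := dir_deriv (inv_mu kappa) q (RtoC 0, RtoC 1)) in *.
  set (mD := dir_deriv (inv_mu kappa) q (RtoC 0, Ci)) in *.
  clearbody x y y'. split.
  - transitivity
      (dz1bar X / 2 * (e1 m zA (Cconj zA) + Ci * e1 m zB (Cconj zB))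
       + dz2bar X / 2 * (e1 m zC (Cconj zC) + Ci * e1 m zD (Cconj zD)))%C;
      [unfold e1; field|].
    rewrite A1, B1, C1, D1.
    transitivity ((dz1bar X * x + dz2bar X * y) / 2 * (1 + Ci * Ci))%C;
      [field|rewrite HCi; ring].
  - transitivity
      (dz1bar X / 2 * (e2 kappa z m zA (Cconj zA) mA + Ci * e2 kappa z m zB (Cconj zB) mB)
       + dz2bar X / 2
         * (e2 kappa z m zC (Cconj zC) mC + Ci * e2 kappa z m zD (Cconj zD) mD))%C;
      [unfold e2; field|].
    rewrite A2, B2, C2, D2.
    transitivity ((dz2bar X * x - dz1bar X * y') / 2 * (1 + Ci * Ci))%C;
      [field|rewrite HCi; ring].
Qed.

Lemma biholomorphic_beta :
  biholomorphic_onto_image Z_int (T01_Z (sigma_k kappa)) T01_C2 (beta_k kappa).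
Proof.
  split; [|split].
  - apply open_ext with (dom_mu kappa).
    + intros q. symmetry. apply image_beta.
    + apply inv_domain_smooth.
  - now apply holomorphic_on_beta.
  - exists (beta_inv kappa). split.
    + apply beta_inv_beta.
    + apply holomorphic_on_beta_inv.
Qed.

End Inverse.

(** * Geodesics *)

(** [tau] gives the parameter of the explicit geodesics below as a function of arc length, and [T]
    is the time at which it reaches [u]. Oddness lets the same function run the geodesic backwards.
    The differential equation is asked only up to [T], since the solution may have poles. *)
Definition time_change (kappa u T : R) (tau : R -> R) : Prop :=
  0 <= T /\ tau 0 = 0 /\ tau T = u /\
  (forall t, tau (- t) = - tau t) /\
  (forall t, 0 < t < T -> 0 < tau t < u) /\
  (forall t, - T <= t <= T -> is_derive tau t (1 + kappa * tau t ^ 2)).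

(** With [k = sqrt |kappa|], the solutions are [tanh (k t) / k], [t] and [tan (k t) / k] according
    to the sign of [kappa]. For [kappa < 0] the condition on [u] keeps it below the asymptote
    [1 / k]. *)
Lemma time_change_exists (kappa u : R) :
  0 <= u -> 0 < 1 + kappa * u ^ 2 -> exists T tau, time_change kappa u T tau.
Proof.
  intros Hu Hk. destruct (Rtotal_order kappa 0) as [Hneg|[->|Hpos]].
  - set (k := sqrt (- kappa)).
    assert (Hk0 : 0 < k) by (apply sqrt_lt_R0; lra).
    assert (Hkk : kappa = - (k * k)) by (unfold k; rewrite sqrt_sqrt; lra).
    assert (Hku : 0 <= k * u < 1) by (split; nra).
    set (tau := fun t => (exp (2 * k * t) - 1) / ((exp (2 * k * t) + 1) * k)).
    set (T := ln ((1 + k * u) / (1 - k * u)) / (2 * k)).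
    assert (HT : tau T = u).
    { unfold tau, T.
      replace (2 * k * _) with (ln ((1 + k * u) / (1 - k * u))) by (field; lra).
      rewrite exp_ln by (apply Rdiv_lt_0_compat; lra). field. lra. }
    assert (Hmono : forall s t, s < t -> tau s < tau t).
    { intros s t Hst. unfold tau.
      assert (E : exp (2 * k * s) < exp (2 * k * t)) by (apply exp_increasing; nra).
      pose proof (exp_pos (2 * k * s)). pose proof (exp_pos (2 * k * t)).
      set (a := exp (2 * k * s)) in *. set (c := exp (2 * k * t)) in *.
      apply Rminus_lt_0.
      replace (_ - _) with (2 * (c - a) / ((c + 1) * (a + 1) * k)) by (field; lra).
      apply Rdiv_lt_0_compat; [lra|].
      repeat apply Rmult_lt_0_compat; lra. }
    assert (H0 : tau 0 = 0).
    { unfold tau. rewrite Rmult_0_r, exp_0. field. lra. }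
    exists T, tau. split; [|split; [exact H0|split; [exact HT|split; [|split]]]].
    + destruct (Rle_lt_dec 0 T) as [|HT0]; auto. apply Hmono in HT0. lra.
    + intros t. unfold tau. replace (2 * k * - t) with (- (2 * k * t)) by ring.
      rewrite exp_Ropp. pose proof (exp_pos (2 * k * t)). field. lra.
    + intros t [Ht1 Ht2]. apply Hmono in Ht1, Ht2. lra.
    + intros t _. unfold tau. pose proof (exp_pos (2 * k * t)). auto_derive.
      * assert (0 < (exp (2 * k * t) + 1) * k) by (apply Rmult_lt_0_compat; lra). lra.
      * rewrite Hkk. field. lra.
  - exists u, (fun t => t). do 5 (split; [solve [auto]|]).
    intros t _. evar_last; [apply @is_derive_id|]. unfold one; simpl. ring.
  - set (k := sqrt kappa).
    assert (Hk0 : 0 < k) by now apply sqrt_lt_R0.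
    assert (Hkk : kappa = k * k) by (unfold k; rewrite sqrt_sqrt; lra).
    pose proof (atan_bound (k * u)) as Hb.
    assert (Hb0 : 0 <= atan (k * u)).
    { rewrite <- atan_0. destruct (Req_dec u 0) as [->|Hu0].
      - rewrite Rmult_0_r. lra.
      - left. apply atan_increasing. apply Rmult_lt_0_compat; lra. }
    set (T := atan (k * u) / k).
    assert (HkT : k * T = atan (k * u)) by (unfold T; field; lra).
    exists T, (fun t => tan (k * t) / k).
    split; [|split; [|split; [|split; [|split]]]].
    + apply Rmult_le_pos; [exact Hb0|left; now apply Rinv_0_lt_compat].
    + rewrite Rmult_0_r, tan_0. field. lra.
    + rewrite HkT, tan_atan. field. lra.
    + intros t. replace (k * - t) with (- (k * t)) by ring.
      rewrite tan_neg. field. lra.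
    + intros t [Ht1 Ht2].
      assert (0 < k * t) by now apply Rmult_lt_0_compat.
      assert (k * t < atan (k * u)) by (rewrite <- HkT; now apply Rmult_lt_compat_l).
      assert (0 < tan (k * t)) by (rewrite <- tan_0; apply tan_increasing; lra).
      assert (tan (k * t) < k * u).
      { rewrite <- (tan_atan (k * u)). apply tan_increasing; lra. }
      split; [now apply Rdiv_lt_0_compat|].
      apply (Rmult_lt_reg_l k); [lra|]. field_simplify; lra.
    + intros t Ht.
      assert (- (PI / 2) < k * t < PI / 2).
      { assert (- (k * T) <= k * t <= k * T) by (split; nra). lra. }
      assert (Hc : cos (k * t) <> 0) by (apply Rgt_not_eq, cos_gt_0; lra).
      evar_last.
      * apply (is_derive_ext (fun t => / k * tan (k * t)));
          [intros s; match goal with |- ?x = ?y => change (@eq R x y) end; field; lra|].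
        apply is_derive_scal, (is_derive_comp tan (fun t => k * t)).
        -- now apply is_derive_tan.
        -- apply is_derive_scal, @is_derive_id.
      * rewrite Hkk. unfold scal, mult, one; simpl. unfold mult; simpl. field. lra.
Qed.

(** With [n = |z0|^2] and [b = Re (conj z0 mu)], the geodesic through [z0] in
    the direction [mu] is [v |-> (z0 + v mu) / (1 - kappa conj z0 mu v)], and
    [N], [D] are the squared moduli of numerator and denominator. *)
Section Exit_parameter.

Variables kappa r n b : R.
Hypothesis hkr : Rabs kappa * r ^ 2 < 1.
Hypothesis hn : b ^ 2 <= n <= r ^ 2.

Let N (v : R) : R := n + 2 * b * v + v ^ 2.
Let D (v : R) : R := 1 - 2 * kappa * b * v + kappa ^ 2 * n * v ^ 2.

Lemma kr_bound : - 1 < kappa * r ^ 2 < 1.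
Proof.
  pose proof (Rle_abs kappa). pose proof (Rle_abs (- kappa)) as H1.
  rewrite Rabs_Ropp in H1. split; nra.
Qed.

Lemma kn_bound : - 1 < kappa * n < 1.
Proof.
  pose proof (Rle_abs kappa). pose proof (Rle_abs (- kappa)) as H1.
  rewrite Rabs_Ropp in H1. pose proof (pow2_ge_0 b).
  assert (Rabs kappa * n <= Rabs kappa * r ^ 2)
    by (apply Rmult_le_compat_l; [apply Rabs_pos|lra]).
  split; nra.
Qed.

(** As [b^2 <= n], both [N] and [D] are sums of nonnegative terms. If [D v = 0], then [N v = 0] as
    well, so [v = - b] and [n = b^2], and [D v = 0] becomes [1 + kappa n = 0]. *)
Lemma D_pos (v : R) : N v <= r ^ 2 * D v -> 0 < D v.
Proof.
  pose proof kn_bound. intros H0.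
  assert (HN : N v = (v + b) ^ 2 + (n - b ^ 2)) by (unfold N; ring).
  assert (HD : D v = (1 - kappa * b * v) ^ 2 + (kappa * v) ^ 2 * (n - b ^ 2))
    by (unfold D; ring).
  pose proof (pow2_ge_0 (v + b)). pose proof (pow2_ge_0 (1 - kappa * b * v)).
  pose proof (pow2_ge_0 (kappa * v)).
  assert (0 <= D v) by nra.
  destruct (Req_dec (D v) 0) as [E|]; [|lra].
  rewrite E in H0. assert (n = b ^ 2) by lra. assert (v = - b) by nra.
  subst v. rewrite HD in E. replace (n - b ^ 2) with 0 in E by lra.
  assert (E' : 1 + kappa * n = 0) by (replace n with (b ^ 2); nra). lra.
Qed.

(** Staying in the disc means [f = N - r^2 D <= 0], and [f] is quadratic with leading coefficient
    [L > 0] and [f 0 <= 0]; [u] is its larger root. The last clause is the sign of the radial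
    velocity at the exit, see [geo_vel_radial]. *)
Lemma exit_parameter :
  exists u, 0 <= u /\ N u = r ^ 2 * D u /\
    (forall v, 0 < v < u -> N v < r ^ 2 * D v) /\
    (forall v, 0 <= v <= u -> 0 < D v /\ N v <= r ^ 2 * D v) /\
    (forall v, - u <= v <= u -> 0 < 1 + kappa * v ^ 2) /\
    0 <= u * (1 - kappa * n) + b * (1 - kappa * u ^ 2).
Proof.
  pose proof kn_bound as Hkn. pose proof kr_bound as Hkr.
  set (L := 1 - kappa ^ 2 * r ^ 2 * n). set (B := b * (1 + kappa * r ^ 2)).
  set (f := fun v => L * v ^ 2 + 2 * B * v + (n - r ^ 2)).
  assert (Hf : forall v, N v - r ^ 2 * D v = f v)
    by (intros; unfold N, D, f, L, B; ring).
  assert (HL : 0 < L).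
  { unfold L. replace (kappa ^ 2 * r ^ 2 * n) with ((kappa * r ^ 2) * (kappa * n))
      by ring. nra. }
  assert (Hdisc : 0 <= B ^ 2 + L * (r ^ 2 - n)) by (pose proof (pow2_ge_0 B); nra).
  set (rt := sqrt (B ^ 2 + L * (r ^ 2 - n))).
  assert (HR : rt * rt = B ^ 2 + L * (r ^ 2 - n)) by now apply sqrt_sqrt.
  assert (HR0 : 0 <= rt) by apply sqrt_pos.
  set (u := (rt - B) / L).
  assert (HLu : L * u = rt - B) by (unfold u; field; lra).
  assert (HBR : B <= rt).
  { destruct (Rle_lt_dec B rt) as [|HlT]; auto. nra. }
  assert (Hu : 0 <= u).
  { unfold u. apply Rmult_le_pos; [lra|left; now apply Rinv_0_lt_compat]. }
  clearbody u.
  assert (Hfu : f u = 0).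
  { apply (Rmult_eq_reg_l L); [|lra]. unfold f.
    replace (L * _) with ((L * u) ^ 2 + 2 * B * (L * u) + L * (n - r ^ 2)) by ring.
    rewrite HLu. nra. }
  (* Convexity of [f]: on [(0, u)] it lies strictly below the chord from [f 0 <= 0] to [f u = 0]. *)
  assert (Hconv : forall v, u * f v = (u - v) * (n - r ^ 2) - L * u * v * (u - v)).
  { intros v. replace (u * f v) with (u * f v - v * f u) by (rewrite Hfu; ring).
    unfold f. ring. }
  assert (Hneg : forall v, 0 < v < u -> f v < 0).
  { intros v Hv. specialize (Hconv v).
    assert (0 < L * u * v * (u - v)).
    { repeat apply Rmult_lt_0_compat; lra. }
    nra. }
  assert (Hle : forall v, 0 <= v <= u -> N v <= r ^ 2 * D v).
  { intros v Hv. enough (f v <= 0) by (specialize (Hf v); lra).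
    destruct (Req_dec v 0) as [->|]; [unfold f; nra|].
    destruct (Req_dec v u) as [->|]; [lra|]. left. apply Hneg. lra. }
  assert (Hu1 : 0 < 1 + kappa * u ^ 2).
  { assert (HNu := Hf u). rewrite Hfu in HNu.
    assert (HD : 0 < D u) by (apply D_pos; lra).
    (* Divided by [D u], this is the conformal factor at the end point, which is
       [1 + kappa r^2 > 0]. *)
    assert (E : D u + kappa * N u = (1 + kappa * n) * (1 + kappa * u ^ 2))
      by (unfold D, N; ring).
    replace (N u) with (r ^ 2 * D u) in E by lra.
    assert (0 < D u * (1 + kappa * r ^ 2)) by (apply Rmult_lt_0_compat; lra).
    nra. }
  exists u. split; [exact Hu|]. split; [specialize (Hf u); lra|].
  split; [intros v Hv; specialize (Hneg v Hv); specialize (Hf v); lra|].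
  split; [intros v Hv; split; [apply D_pos|]; now apply Hle|].
  split.
  - intros v Hv. assert (0 <= v ^ 2 <= u ^ 2) by (split; nra).
    destruct (Rle_lt_dec 0 kappa); nra.
  (* The sign is that of [L u + B], half the derivative of [f] at [u], and this is the root [rt] of
     the discriminant. *)
  - assert (E : (1 + kappa * r ^ 2) * (u * (1 - kappa * n) + b * (1 - kappa * u ^ 2))
      = (1 + kappa * u ^ 2) * (L * u + B) - kappa * u * f u)
      by (unfold f, L, B; ring).
    rewrite Hfu, HLu in E.
    assert (0 <= (1 + kappa * u ^ 2) * (rt - B + B)) by (apply Rmult_le_pos; lra).
    nra.
Qed.

End Exit_parameter.

(** * Explicit geodesics and the invariance of beta along them *)

Section Geodesics.

Variable kappa : R.

Definition geo_den (z m : C) (v : R) : C := (1 - RtoC kappa * (Cconj z * m) * RtoC v)%C.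

(** The image of the line [v m] through 0 under the isometry [w |-> (z + w) / (1 - kappa conj z w)].
    [geo_vel] is its velocity when [v] moves with speed [1 + kappa v^2], which is unit speed for the
    metric if [|m| = 1]; [geo_dir] is the corresponding coordinate [mu]. *)
Definition geo (z m : C) (v : R) : C := ((z + RtoC v * m) / geo_den z m v)%C.

Definition geo_vel (z m : C) (v : R) : C :=
  (m * conf kappa z * RtoC (1 + kappa * v ^ 2) / (geo_den z m v * geo_den z m v))%C.

Definition geo_dir (z m : C) (v : R) : C :=
  (m * (Cconj (geo_den z m v) / geo_den z m v))%C.

Variables z m : C.
Hypothesis hm : Cmod m = 1.

Lemma unit_mult_conj : (m * Cconj m)%C = RtoC 1.
Proof. rewrite Cmult_conj_Cmod2, hm. f_equal. ring. Qed.

Lemma geo_num_Cmod2 (v : R) :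
  Cmod (z + RtoC v * m)%C ^ 2
    = Cmod z ^ 2 + 2 * Re (Cconj z * m)%C * v + v ^ 2.
Proof.
  pose proof (Cmod2_alt m) as E. rewrite hm in E. rewrite !Cmod2_alt.
  destruct z as [x y], m as [a b]. simpl in *. nra.
Qed.

Lemma geo_den_Cmod2 (v : R) :
  Cmod (geo_den z m v) ^ 2
    = 1 - 2 * kappa * Re (Cconj z * m)%C * v + kappa ^ 2 * Cmod z ^ 2 * v ^ 2.
Proof.
  pose proof (Cmod2_alt m) as E. rewrite hm in E. unfold geo_den.
  rewrite !Cmod2_alt. destruct z as [x y], m as [a b]. simpl in *.
  replace (x * (x * 1) + y * (y * 1)) with ((x * x + y * y) * (a * a + b * b))
    by (replace (a * a + b * b) with 1 by lra; ring).
  ring.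
Qed.

Lemma geo_den_conj (v : R) :
  Cconj (geo_den z m v) = (1 - RtoC kappa * (z * Cconj m) * RtoC v)%C.
Proof.
  unfold geo_den. rewrite Cminus_conj, !Cmult_conj, Cconj_conj, !RtoC_conj. ring.
Qed.

Lemma Cconj_neq_0 (c : C) : c <> RtoC 0 -> Cconj c <> RtoC 0.
Proof.
  intros Hc E. apply Hc. rewrite <- (Cconj_conj c), E. apply RtoC_conj.
Qed.

Lemma geo_conj (v : R) :
  geo_den z m v <> RtoC 0 ->
  Cconj (geo z m v)
    = ((Cconj z + RtoC v * Cconj m) / Cconj (geo_den z m v))%C.
Proof.
  intros H. unfold geo.
  now rewrite Cdiv_conj, Cplus_conj, Cmult_conj, RtoC_conj by exact H.
Qed.

Lemma mobius_factor (v : R) :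
  RtoC (1 + kappa * v ^ 2) = (1 + RtoC kappa * (RtoC v * RtoC v))%C.
Proof. rewrite RtoC_plus, RtoC_mult, RtoC_pow. f_equal. f_equal. simpl. ring. Qed.

(** The transformation rule of the conformal factor under the isometry, with [|v m|^2 = v^2]. *)
Lemma conf_geo (v : R) :
  geo_den z m v <> RtoC 0 ->
  conf kappa (geo z m v) =
    (conf kappa z * RtoC (1 + kappa * v ^ 2)
     / (geo_den z m v * Cconj (geo_den z m v)))%C.
Proof.
  intros H. pose proof (Cconj_neq_0 _ H) as H'. unfold conf at 1.
  rewrite geo_conj by exact H. unfold geo. rewrite mobius_factor.
  pose proof unit_mult_conj as Hu. pose proof (geo_den_conj v) as Ec.
  replace (1 + _)%C with
    ((geo_den z m v * Cconj (geo_den z m v)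
      + RtoC kappa * ((z + RtoC v * m) * (Cconj z + RtoC v * Cconj m)))
     / (geo_den z m v * Cconj (geo_den z m v)))%C by (field; auto).
  f_equal. rewrite Ec. unfold geo_den, conf.
  transitivity (1 + RtoC kappa * (z * Cconj z)
    + RtoC kappa * (RtoC v * RtoC v) * (m * Cconj m)
    + RtoC kappa * (RtoC v * RtoC v) * (RtoC kappa * (z * Cconj z)) * (m * Cconj m))%C.
  - ring.
  - rewrite Hu. ring.
Qed.

Lemma conf_geo_pos (v : R) :
  geo_den z m v <> RtoC 0 ->
  0 < 1 + kappa * Cmod z ^ 2 -> 0 < 1 + kappa * v ^ 2 ->
  0 < 1 + kappa * Cmod (geo z m v) ^ 2.
Proof.
  intros H Hz Hv. pose proof (conf_geo v H) as E. apply Cmod_gt_0 in H.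
  assert (0 < Cmod (geo_den z m v) ^ 2) by now apply pow_lt.
  rewrite <- !conf_RtoC, Cmult_conj_Cmod2, <- RtoC_mult, <- RtoC_div in E by lra.
  apply RtoC_inj in E. rewrite E.
  apply Rdiv_lt_0_compat; [now apply Rmult_lt_0_compat|assumption].
Qed.

Lemma geo_dir_vel (v : R) :
  geo_den z m v <> RtoC 0 ->
  (conf kappa (geo z m v) * geo_dir z m v)%C = geo_vel z m v.
Proof.
  intros H. pose proof (Cconj_neq_0 _ H) as H'. rewrite conf_geo by exact H.
  unfold geo_dir, geo_vel. field. auto.
Qed.

Lemma geo_is_derive (tau : R -> R) (t : R) :
  is_derive tau t (1 + kappa * tau t ^ 2) ->
  geo_den z m (tau t) <> RtoC 0 ->
  0 < 1 + kappa * Cmod z ^ 2 -> 0 < 1 + kappa * tau t ^ 2 ->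
  is_derive (K := R_AbsRing) (V := CR) (fun s => geo z m (tau s)) t (geo_vel z m (tau t)) /\
  exists acc : CR,
    is_derive (K := R_AbsRing) (V := CR) (fun s => geo_vel z m (tau s)) t acc /\
    covariant_acceleration (sigma_k kappa) (geo z m (tau t)) (geo_vel z m (tau t)) acc
      = RtoC 0.
Proof.
  intros Ht Hd Hz Hv.
  pose proof (is_Cderive_RtoC _ _ _ Ht) as HC.
  assert (HD := is_Cderive_minus _ _ _ _ _ (is_Cderive_const (RtoC 1) t)
     (is_Cderive_mult _ _ _ _ _
       (is_Cderive_const (RtoC kappa * (Cconj z * m))%C t) HC)).
  cbv beta in HD.
  change (fun s : R_AbsRing => _ : C) with (fun s => geo_den z m (tau s)) in HD.
  pose proof (Cconj_neq_0 _ Hd) as Hd'.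
  split.
  - evar_last.
    + apply (is_Cderive_div _ _ _ _ _
        (is_Cderive_plus _ _ _ _ _ (is_Cderive_const z t)
          (is_Cderive_mult _ _ _ _ _ HC (is_Cderive_const m t))) HD Hd).
    + cbv beta. unfold geo_vel. rewrite mobius_factor. unfold conf, geo_den in *.
      field. exact Hd.
  - assert (HV := is_Cderive_div _ _ _ _ _
       (is_Cderive_mult _ _ _ _ _ (is_Cderive_const (m * conf kappa z)%C t)
         (is_Cderive_plus _ _ _ _ _ (is_Cderive_const (RtoC 1) t)
           (is_Cderive_mult _ _ _ _ _ (is_Cderive_const (RtoC kappa) t)
             (is_Cderive_mult _ _ _ _ _ HC HC))))
       (is_Cderive_mult _ _ _ _ _ HD HD) (Cmult_neq_0 _ _ Hd Hd)).
    cbv beta in HV. eexists. split.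
    + eapply is_derive_ext; [|exact HV]. intros s. unfold geo_vel.
      now rewrite mobius_factor.
    + unfold covariant_acceleration.
      rewrite dz_sigma_k by now apply conf_geo_pos.
      rewrite conf_geo, geo_conj by exact Hd.
      pose proof (conf_neq_0 kappa z Hz) as Hz0.
      assert (Hv0 : RtoC (1 + kappa * tau t ^ 2) <> RtoC 0) by (apply RtoC_neq_0; lra).
      unfold geo_vel. rewrite mobius_factor in *.
      pose proof unit_mult_conj as Hu.
      set (d := geo_den z m (tau t)) in *. set (d' := Cconj d) in *.
      (* The last factor vanishes: [tau d = tau - kappa conj z m tau^2] by definition of [d], and
         [m conj m = 1]. *)
      transitivity (2 * RtoC kappa * m * conf kappa z
        * (1 + RtoC kappa * (RtoC (tau t) * RtoC (tau t))) / (d * d * d)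
        * (RtoC (tau t) * d + Cconj z * m * RtoC kappa * (RtoC (tau t) * RtoC (tau t))
           - RtoC (tau t) * (m * Cconj m)))%C.
      * field. auto.
      * rewrite Hu. unfold d at 4, geo_den. ring.
Qed.

Lemma geo_0 : geo z m 0 = z.
Proof. unfold geo, geo_den. field. Qed.

Lemma geo_vel_0 : geo_vel z m 0 = (conf kappa z * m)%C.
Proof.
  unfold geo_vel, geo_den. rewrite mobius_factor. field.
Qed.

(** The last factor is the quantity whose sign [exit_parameter] controls, with [n = |z|^2] and
    [b = Re (conj z m)]. *)
Lemma geo_vel_radial (v : R) :
  geo_den z m v <> RtoC 0 ->
  Re (geo_vel z m v * Cconj (geo z m v))%C =
    (1 + kappa * Cmod z ^ 2) * (1 + kappa * v ^ 2) / (Cmod (geo_den z m v) ^ 2) ^ 2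
    * (v * (1 - kappa * Cmod z ^ 2) + Re (Cconj z * m)%C * (1 - kappa * v ^ 2)).
Proof.
  intros H. pose proof (Cconj_neq_0 _ H) as H'. rewrite geo_conj by exact H.
  pose proof unit_mult_conj as Hu.
  set (x := (1 + kappa * Cmod z ^ 2) * (1 + kappa * v ^ 2)
            / (Cmod (geo_den z m v) ^ 2) ^ 2).
  assert (Hx : RtoC x = (conf kappa z * RtoC (1 + kappa * v ^ 2)
    / (geo_den z m v * Cconj (geo_den z m v)
       * (geo_den z m v * Cconj (geo_den z m v))))%C).
  { assert (0 < Cmod (geo_den z m v) ^ 2) by now apply pow_lt, Cmod_gt_0.
    unfold x. rewrite Cmult_conj_Cmod2, <- conf_RtoC, <- !RtoC_mult, <- RtoC_div.
    - f_equal. set (y := Cmod (geo_den z m v) ^ 2) in *. clearbody y.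
      field. lra.
    - apply Rgt_not_eq. now apply Rmult_lt_0_compat. }
  replace (geo_vel z m v * _)%C with
    (RtoC x * ((Cconj z * m + RtoC v) * Cconj (geo_den z m v)))%C.
  - rewrite re_scal_l. f_equal. rewrite geo_den_conj.
    pose proof (Cmod2_alt m) as E. rewrite hm in E. rewrite Cmod2_alt.
    destruct z as [a b], m as [c d]. simpl in *.
    replace (a * (a * 1) + b * (b * 1)) with ((a * a + b * b) * (c * c + d * d))
      by (replace (c * c + d * d) with 1 by lra; ring).
    ring.
  - rewrite Hx. unfold geo_vel.
    replace (Cconj z * m + RtoC v)%C with (m * (Cconj z + RtoC v * Cconj m))%C.
    + field. auto.
    + transitivity (Cconj z * m + RtoC v * (m * Cconj m))%C; [ring|].
      rewrite Hu. ring.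
Qed.

(** Along the geodesic [a = conj z mu] becomes [(a + v) / geo_den]. Consequently [den] and
    [z - mu^2 conj z] are both multiplied by [(1 + kappa v^2) / geo_den^2], and so is [mu conf]. *)
Lemma beta_geo (v : R) :
  geo_den z m v <> RtoC 0 -> den kappa z m <> RtoC 0 -> 0 < 1 + kappa * v ^ 2 ->
  beta_k kappa (geo z m v, geo_dir z m v) = beta_k kappa (z, m).
Proof.
  intros H Hd Hv. pose proof (Cconj_neq_0 _ H) as H'.
  assert (Hv0 : RtoC (1 + kappa * v ^ 2) <> RtoC 0) by (apply RtoC_neq_0; lra).
  rewrite !beta_k_eq. cbn [fst snd]. rewrite conf_geo by exact H.
  pose proof unit_mult_conj as Hu.
  assert (Ha : (geo_dir z m v * Cconj (geo z m v))%C
               = ((Cconj z * m + RtoC v) / geo_den z m v)%C).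
  { rewrite geo_conj by exact H. unfold geo_dir.
    transitivity ((Cconj z * m + RtoC v * (m * Cconj m)) / geo_den z m v)%C.
    - field. auto.
    - rewrite Hu. f_equal. ring. }
  assert (Hden : den kappa (geo z m v) (geo_dir z m v)
    = (RtoC (1 + kappa * v ^ 2) * den kappa z m
       / (geo_den z m v * geo_den z m v))%C).
  { unfold den at 1.
    replace (RtoC kappa * _ * _)%C with
      (RtoC kappa * ((geo_dir z m v * Cconj (geo z m v))
                     * (geo_dir z m v * Cconj (geo z m v))))%C by ring.
    rewrite Ha, mobius_factor. unfold den, geo_den in *. field. exact H. }
  rewrite Hden. apply injective_projections; cbn [fst snd];
    match goal with |- ?a = ?b => change (@eq C a b) end.
  - replace (geo z m v - _)%C with
      (RtoC (1 + kappa * v ^ 2) * (z - m * m * Cconj z)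
       / (geo_den z m v * geo_den z m v))%C.
    + field. auto.
    + rewrite <- (Cmult_assoc (geo_dir z m v)), Ha, mobius_factor.
      unfold geo, geo_dir. rewrite geo_den_conj.
      transitivity
       (((z + RtoC v * m) * geo_den z m v
         - (1 * m - RtoC kappa * z * (m * Cconj m) * RtoC v) * (Cconj z * m + RtoC v))
        / (geo_den z m v * geo_den z m v))%C.
      * rewrite Hu. f_equal. unfold geo_den. ring.
      * field. exact H.
  - unfold geo_dir. field. auto.
Qed.

Lemma geo_dir_unit (v : R) : geo_den z m v <> RtoC 0 -> Cmod (geo_dir z m v) = 1.
Proof.
  intros H. unfold geo_dir. rewrite Cmod_mult, hm, Cmod_div, Cmod_conj by exact H.
  apply Cmod_gt_0 in H. field. lra.
Qed.

End Geodesics.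

Lemma geo_opp (kappa : R) (z m : C) (v : R) :
  geo kappa z m (- v) = geo kappa z (- m)%C v.
Proof. unfold geo, geo_den. rewrite RtoC_opp. f_equal; [|f_equal]; ring. Qed.

(** * Exit times and the flow back to the boundary of the larger disc *)

Section Exit.

Variables kappa r : R.
Hypothesis hr : 0 < r.
Hypothesis hkr : Rabs kappa * r ^ 2 < 1.

Lemma conf_pos_r (z : C) : Cmod z <= r -> 0 < 1 + kappa * Cmod z ^ 2.
Proof.
  intros Hz. pose proof (Cmod_ge_0 z).
  assert (0 <= Cmod z ^ 2 <= r ^ 2) by (split; nra).
  pose proof (kn_bound kappa r (Cmod z ^ 2) 0). lra.
Qed.

(** Reduces the sign conditions for exit, influx and convexity to the sign of the radial component
    [Re (w conj x)]. *)
Lemma metric_normal (x w : C) :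
  metric (sigma_k kappa) x w (normal (sigma_k kappa) r x)
    = - (exp (2 * sigma_k kappa x) * (exp (- sigma_k kappa x) / r))
      * Re (w * Cconj x)%C.
Proof.
  unfold metric, normal. rewrite Copp_conj, Cmult_conj, RtoC_conj.
  replace (w * _)%C with
    (RtoC (- (exp (- sigma_k kappa x) / r)) * (w * Cconj x))%C
    by (rewrite RtoC_opp; ring).
  rewrite re_scal_l. ring.
Qed.

(** Translates [exit_parameter] by [|geo v|^2 = N v / D v], the denominator being positive up to the
    exit. *)
Lemma exit_geodesic (z m : C) :
  Cmod z <= r -> Cmod m = 1 ->
  exists u T tau, time_change kappa u T tau /\
    (forall v, 0 < v < u -> Cmod (geo kappa z m v) < r) /\
    (forall v, 0 <= v <= u ->
       geo_den kappa z m v <> RtoC 0 /\ Cmod (geo kappa z m v) <= r) /\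
    (forall v, - u <= v <= u -> 0 < 1 + kappa * v ^ 2) /\
    Cmod (geo kappa z m u) = r /\
    0 <= Re (geo_vel kappa z m u * Cconj (geo kappa z m u))%C.
Proof.
  intros Hz Hm.
  set (n := Cmod z ^ 2). set (b := Re (Cconj z * m)%C).
  assert (Hn : b ^ 2 <= n <= r ^ 2).
  { pose proof (Cmod_ge_0 z). split; [|unfold n; nra].
    pose proof (re_le_Cmod (Cconj z * m)) as H1.
    rewrite Cmod_conj_mult, Hm, Rmult_1_r in H1. fold b in H1.
    unfold n. rewrite <- pow2_abs. apply pow_incr. split; [apply Rabs_pos|exact H1]. }
  destruct (exit_parameter kappa r n b hkr Hn)
    as (u & Hu & HNu & Hlt & Hle & Hpos & Hdir).
  destruct (time_change_exists kappa u Hu) as (T & tau & Htau).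
  { apply Hpos. lra. }
  assert (Hden : forall v, 0 <= v <= u -> geo_den kappa z m v <> RtoC 0).
  { intros v Hv E. destruct (Hle v Hv) as [HD _].
    rewrite <- (geo_den_Cmod2 kappa z m Hm), E, Cmod_0 in HD. lra. }
  assert (Hgeo : forall v, 0 <= v <= u ->
    Cmod (geo kappa z m v) ^ 2 * Cmod (geo_den kappa z m v) ^ 2
      = n + 2 * b * v + v ^ 2 /\ 0 < Cmod (geo_den kappa z m v) ^ 2).
  { intros v Hv. specialize (Hden v Hv). split.
    - unfold geo. rewrite Cmod_div, <- (geo_num_Cmod2 z m Hm) by exact Hden.
      apply Cmod_gt_0 in Hden. field. lra.
    - now apply pow_lt, Cmod_gt_0. }
  exists u, T, tau. split; [exact Htau|].
  split; [|split; [|split; [exact Hpos|split]]].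
  - intros v Hv. destruct (Hgeo v) as [H1 H2]; [lra|].
    specialize (Hlt v Hv). rewrite <- H1, <- (geo_den_Cmod2 kappa z m Hm) in Hlt.
    apply Rmult_lt_reg_r in Hlt; auto.
    pose proof (Cmod_ge_0 (geo kappa z m v)). nra.
  - intros v Hv. split; [now apply Hden|].
    destruct (Hgeo v Hv) as [H1 H2]. destruct (Hle v Hv) as [_ H].
    rewrite <- H1, <- (geo_den_Cmod2 kappa z m Hm) in H.
    apply Rmult_le_reg_r in H; auto.
    pose proof (Cmod_ge_0 (geo kappa z m v)). nra.
  - destruct (Hgeo u) as [H1 H2]; [lra|].
    rewrite <- H1, <- (geo_den_Cmod2 kappa z m Hm) in HNu.
    apply Rmult_eq_reg_r in HNu; [|lra].
    pose proof (Cmod_ge_0 (geo kappa z m u)). nra.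
  - rewrite geo_vel_radial; auto; [|apply Hden; lra].
    pose proof (conf_pos_r z Hz). pose proof (Hpos u).
    apply Rmult_le_pos; [|exact Hdir].
    apply Rmult_le_pos; [apply Rmult_le_pos; lra|].
    left. apply Rinv_0_lt_compat, pow_lt, pow_lt, Cmod_gt_0, Hden. lra.
Qed.

Lemma chart_geo (z m : C) (v : R) :
  Cmod m = 1 -> geo_den kappa z m v <> RtoC 0 ->
  0 < 1 + kappa * Cmod z ^ 2 -> 0 < 1 + kappa * v ^ 2 ->
  chart (sigma_k kappa) (geo kappa z m v, geo_dir kappa z m v)
    = (geo kappa z m v, geo_vel kappa z m v).
Proof.
  intros Hm H Hz Hv. unfold chart. cbn [fst snd].
  rewrite (proj2 (exp_sigma_k kappa _ (conf_geo_pos kappa z m Hm v H Hz Hv))).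
  now rewrite conf_RtoC, geo_dir_vel.
Qed.

Lemma chart_geo_0 (z m : C) :
  0 < 1 + kappa * Cmod z ^ 2 ->
  chart (sigma_k kappa) (z, m) = (geo kappa z m 0, geo_vel kappa z m 0).
Proof.
  intros Hz. rewrite geo_0, geo_vel_0. unfold chart. cbn [fst snd].
  now rewrite (proj2 (exp_sigma_k kappa z Hz)), conf_RtoC.
Qed.

Lemma time_change_bound (u T : R) (tau : R -> R) (t : R) :
  time_change kappa u T tau -> 0 <= t <= T -> 0 <= tau t <= u.
Proof.
  intros (HT & H0 & HTu & _ & Hin & _) Ht.
  assert (Hu : 0 <= u).
  { destruct (Req_dec T 0) as [E|]; [subst T; lra|].
    specialize (Hin (T / 2)). lra. }
  destruct (Req_dec t 0) as [->|]; [lra|].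
  destruct (Req_dec t T) as [->|]; [lra|].
  specialize (Hin t). lra.
Qed.

(** One computation serves twice: by [geo_opp] and oddness of [tau], the geodesic of [(z, - m)] up
    to its exit is that of [(z, m)] run backwards. The end point has parameter [- u], where
    [beta_geo] applies. *)
Lemma exit_and_flow_back (z m : C) :
  Cmod z <= r -> Cmod m = 1 ->
  exists T q, exit_time (sigma_k kappa) r (z, (- m)%C) T /\
    flow (sigma_k kappa) r (- T) (z, m) q /\
    Cmod (fst q) = r /\ Cmod (snd q) = 1 /\ beta_k kappa q = beta_k kappa (z, m).
Proof.
  intros Hz Hm. pose proof (conf_pos_r z Hz) as Hz0.
  assert (Hm' : Cmod (- m)%C = 1) by now rewrite Cmod_opp.
  destruct (exit_geodesic z (- m)%C Hz Hm')
    as (u & T & tau & Htau & Hlt & Hle & Hpos & Hu & Hdir).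
  pose proof (time_change_bound u T tau) as Hb.
  pose proof Htau as (HT & H0 & HTu & Hodd & Hin & Hder).
  assert (Hden : forall v, 0 <= v <= u -> geo_den kappa z m (- v) <> RtoC 0).
  { intros v Hv E. apply (proj1 (Hle v Hv)). rewrite <- E.
    unfold geo_den. rewrite RtoC_opp. ring. }
  assert (Hu0 : 0 <= u) by (specialize (Hb T Htau); lra).
  exists T, (geo kappa z m (- u), geo_dir kappa z m (- u)).
  split; [|split; [|split; [|split]]].
  - split; [exact HT|].
    exists (fun t => geo kappa z (- m)%C (tau t)), (fun t => geo_vel kappa z (- m)%C (tau t)).
    split; [|split; [|split; [|split]]].
    + intros t Ht. specialize (Hb t Htau Ht).
      apply geo_is_derive; auto; [apply Hder; lra|apply (Hle _ Hb)|apply Hpos; lra].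
    + rewrite H0. symmetry. now apply chart_geo_0.
    + intros t Ht. apply Hlt, Hin, Ht.
    + now rewrite HTu.
    + rewrite HTu, metric_normal.
      rewrite Ropp_mult_distr_l_reverse. apply Rge_le, Ropp_0_le_ge_contravar.
      apply Rmult_le_pos; [|exact Hdir].
      apply Rmult_le_pos; [left; apply exp_pos|].
      left. apply Rdiv_lt_0_compat; [apply exp_pos|exact hr].
  - exists (fun t => geo kappa z m (tau t)), (fun t => geo_vel kappa z m (tau t)).
    rewrite Rmin_right, Rmax_left by lra.
    assert (Hneg : forall t, - T <= t <= 0 -> exists v, tau t = - v /\ 0 <= v <= u).
    { intros t Ht. exists (tau (- t)). rewrite Hodd. split; [lra|].
      rewrite <- Hodd. apply Hb; auto. lra. }
    split; [|split; [|split]].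
    + intros t Ht. destruct (Hneg t Ht) as (v & Ev & Hv).
      apply geo_is_derive; auto.
      * apply Hder. lra.
      * rewrite Ev. now apply Hden.
      * apply Hpos. lra.
    + rewrite H0. symmetry. now apply chart_geo_0.
    + rewrite Hodd, HTu. symmetry. apply chart_geo; auto.
      * apply Hden. lra.
      * apply Hpos. lra.
    + intros t Ht. destruct (Hneg t Ht) as (v & -> & Hv).
      rewrite geo_opp. now apply Hle.
  - cbn [fst]. now rewrite geo_opp.
  - cbn [snd]. apply geo_dir_unit; auto. apply Hden. lra.
  - apply beta_geo; auto.
    + apply Hden. lra.
    + apply den_neq_0. rewrite Hm, Rmult_1_r.
      pose proof (Cmod_ge_0 z). assert (0 <= Cmod z ^ 2 <= r ^ 2) by (split; nra).
      pose proof (Rabs_pos kappa). nra.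
    + apply Hpos. lra.
Qed.

Lemma unit_vector_chart (p : C * C) :
  unit_vector (sigma_k kappa) (chart (sigma_k kappa) p) -> Cmod (snd p) = 1.
Proof.
  unfold unit_vector, metric, chart. cbn [fst snd]. intros H.
  assert (E : exp (2 * sigma_k kappa (fst p)) * exp (- sigma_k kappa (fst p)) ^ 2 = 1).
  { simpl. rewrite Rmult_1_r, <- !exp_plus, <- exp_0. f_equal. ring. }
  rewrite Cmult_conj_Cmod2, re_RtoC, Cmod_mult, Cmod_R, Rpow_mult_distr, pow2_abs,
    <- Rmult_assoc, E in H.
  pose proof (Cmod_ge_0 (snd p)). nra.
Qed.

Lemma non_trapping_k : non_trapping (sigma_k kappa) r.
Proof.
  intros [z m] Hz Hm. apply unit_vector_chart in Hm. cbn [fst snd] in *.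
  destruct (exit_and_flow_back z (- m)%C Hz) as (T & _ & H & _).
  - now rewrite Cmod_opp.
  - exists T. now replace m with (- - m)%C by ring.
Qed.

End Exit.

(** * Enlargements and the embedding *)

Section Enlargements.

Variable kappa : R.

(** All factors but the last are positive, so strict convexity amounts to [kappa r^2 < 1]; this is
    used in both directions. *)
Lemma second_fundamental_form (r : R) (x : C) :
  0 < r -> 0 < 1 + kappa * r ^ 2 -> Cmod x = r ->
  metric (sigma_k kappa) x
    (covariant_acceleration (sigma_k kappa) x (Ci * x)%C (- x)%C)
    (normal (sigma_k kappa) r x)
  = exp (2 * sigma_k kappa x) * (exp (- sigma_k kappa x) / r)
    * (r ^ 2 / (1 + kappa * r ^ 2)) * (1 - kappa * r ^ 2).
Proof.
  intros Hr Hq Hx. rewrite metric_normal.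
  assert (Hq' : 0 < 1 + kappa * Cmod x ^ 2) by now rewrite Hx.
  unfold covariant_acceleration. rewrite dz_sigma_k by exact Hq'.
  pose proof (conf_neq_0 kappa x Hq') as H0.
  replace (Re _) with (- (r ^ 2 / (1 + kappa * r ^ 2)) * (1 - kappa * r ^ 2));
    [ring|].
  rewrite <- Hx at 1 2 3. rewrite <- (re_RtoC (_ * _)). f_equal.
  rewrite RtoC_mult, RtoC_opp, RtoC_div, conf_RtoC, RtoC_minus, RtoC_mult,
    <- Cmult_conj_Cmod2 by lra.
  transitivity ((- (x * Cconj x)
     + 2 * (RtoC kappa * Cconj x / conf kappa x) * (x * x) * Cconj x * - (Ci * Ci)))%C.
  - replace (Ci * Ci)%C with (- RtoC 1)%C
      by (apply injective_projections; simpl; ring).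
    unfold conf in *. field. exact H0.
  - field. exact H0.
Qed.

Lemma strictly_convex_boundary_k (r : R) :
  0 < r -> Rabs kappa * r ^ 2 < 1 -> strictly_convex_boundary (sigma_k kappa) r.
Proof.
  intros Hr Hk x Hx.
  pose proof (kn_bound kappa r (r ^ 2) 0 Hk) as Hb.
  assert (Hb' : -1 < kappa * r ^ 2 < 1) by (apply Hb; split; [nra|lra]).
  rewrite second_fundamental_form by (auto; lra).
  repeat apply Rmult_lt_0_compat; try apply exp_pos; try apply Rinv_0_lt_compat; nra.
Qed.

Lemma smooth_on_sigma_k :
  let U := fun x : CR => True /\ 0 < 1 + kappa * Cmod x ^ 2 in
  open U /\ smooth_on (W := R_NormedModule) U (sigma_k kappa).
Proof.
  assert (H : forall U : CR -> Prop, open U ->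
    smooth_on (W := R_NormedModule) U (fun x : CR => 1 + kappa * Cmod x ^ 2)).
  { intros U HU. apply smooth_on_Rplus;
      [apply (smooth_on_const (W := R_NormedModule))|].
    apply smooth_on_Rmult; [apply (smooth_on_const (W := R_NormedModule))|].
    apply (smooth_on_Cmod2 U (fun x => x)); auto.
    apply smooth_on_linear, is_linear_id. }
  assert (HU : open (fun x : CR => True /\ 0 < 1 + kappa * Cmod x ^ 2)).
  { apply (open_positive (fun _ : CR => True)); [apply open_true|].
    apply H, open_true. }
  split; [exact HU|].
  apply (smooth_on_Ropp _ (fun x : CR => ln (1 + kappa * Cmod x ^ 2))).
  apply smooth_on_ln; [now intros p []|]. now apply H.
Qed.

(** [ln] being 0 on the nonpositive numbers, [sigma_k] has junk values where
    [1 + kappa |z|^2 <= 0]; smoothness of [sigma_k] keeps the enlargements away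
    from there. *)
Lemma sigma_k_discontinuous (s : R) :
  0 < s -> kappa * s ^ 2 = -1 -> ~ continuous (sigma_k kappa) (RtoC s : CR).
Proof.
  intros Hs Hk Hc.
  assert (Hc' : continuous (fun t : R => sigma_k kappa (RtoC t)) s).
  { apply (continuous_comp (V := CR) RtoC (sigma_k kappa)); [|exact Hc].
    apply @ex_derive_continuous. exists (RtoC 1).
    apply is_Cderive_RtoC, @is_derive_id. }
  set (f := fun t : R => sigma_k kappa (RtoC t)) in *.
  set (M := f s + 1).
  destruct (Hc' (fun y => y < M)) as [delta Hdelta].
  { apply open_lt. unfold M. simpl. lra. }
  (* The last bound makes the argument of [ln] at [s - eps], which is at most [2 eps / s], no larger
     than [exp (- M)]; then [sigma_k] is at least [M] there, against continuity. *)
  set (eps := Rmin (delta / 2) (Rmin (s / 2) (s * exp (- M) / 2))).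
  pose proof (cond_pos delta) as Hd. pose proof (exp_pos (- M)) as He.
  assert (Heps : 0 < eps) by (unfold eps; repeat apply Rmin_glb_lt; nra).
  assert (E1 : eps <= delta / 2) by apply Rmin_l.
  assert (E2 : eps <= s / 2) by (eapply Rle_trans; [apply Rmin_r|apply Rmin_l]).
  assert (E3 : eps <= s * exp (- M) / 2) by (eapply Rle_trans; [apply Rmin_r|apply Rmin_r]).
  clearbody eps.
  assert (HM : f (s - eps) < M).
  { apply Hdelta. unfold ball; simpl. unfold AbsRing_ball, abs, minus, plus, opp; simpl.
    apply Rabs_def1; lra. }
  unfold f, sigma_k in HM. rewrite Cmod_R, pow2_abs in HM.
  set (y := 1 + kappa * (s - eps) ^ 2) in HM.
  assert (Hy : y = (2 * s - eps) * eps / s ^ 2).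
  { unfold y. apply (Rmult_eq_reg_r (s ^ 2)); [|nra].
    replace ((1 + kappa * (s - eps) ^ 2) * s ^ 2)
      with (s ^ 2 + (kappa * s ^ 2) * (s - eps) ^ 2) by ring.
    rewrite Hk. field. lra. }
  assert (Hy0 : 0 < y) by (rewrite Hy; apply Rdiv_lt_0_compat; nra).
  assert (Hy1 : y <= exp (- M)).
  { rewrite Hy. apply (Rmult_le_reg_r (s ^ 2)); [nra|].
    replace ((2 * s - eps) * eps / s ^ 2 * s ^ 2) with ((2 * s - eps) * eps)
      by (field; lra).
    assert (2 * s * eps <= 2 * s * (s * exp (- M) / 2))
      by (apply Rmult_le_compat_l; lra).
    nra. }
  apply ln_le in Hy1; auto. rewrite ln_exp in Hy1. lra.
Qed.

(** If [1 + kappa r^2 <= 0], the disc would contain points with [|z| = 1 / sqrt (- kappa)], where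
    [sigma_k] is discontinuous, so smoothness excludes this. The bound [kappa r^2 < 1] is strict
    convexity. *)
Lemma enlargement_bound (r : R) :
  enlargement (sigma_k kappa) r -> 1 < r /\ Rabs kappa * r ^ 2 < 1.
Proof.
  intros (Hr & (U & _ & HU & Hs) & _ & Hconv). split; [exact Hr|].
  assert (Hq : 0 < 1 + kappa * r ^ 2).
  { destruct (Rlt_le_dec 0 (1 + kappa * r ^ 2)) as [|Hle]; auto. exfalso.
    assert (Hk : 0 < - kappa) by nra.
    assert (Hk' := sqrt_lt_R0 _ Hk). pose proof (sqrt_sqrt _ (Rlt_le _ _ Hk)) as E.
    set (k := sqrt (- kappa)) in *.
    assert (Hk0 : 0 < / k) by now apply Rinv_0_lt_compat.
    apply (sigma_k_discontinuous (/ k)); auto.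
    - replace kappa with (- (k * k)) by lra. field. lra.
    - apply (smooth_on_continuous U (W := R_NormedModule)); auto.
      apply HU. rewrite Cmod_R, Rabs_pos_eq by lra.
      assert (1 <= k * r).
      { assert (0 < k * r) by nra.
        assert ((k * r) * (k * r) = - kappa * r ^ 2) by (rewrite <- E; ring). nra. }
      apply (Rmult_le_reg_l k); auto. rewrite Rinv_r; lra. }
  assert (Hx : Cmod (RtoC r) = r) by (rewrite Cmod_R, Rabs_pos_eq; lra).
  specialize (Hconv (RtoC r) Hx).
  rewrite second_fundamental_form in Hconv by (auto; lra).
  assert (Hp : 0 < exp (2 * sigma_k kappa (RtoC r)) * (exp (- sigma_k kappa (RtoC r)) / r)
    * (r ^ 2 / (1 + kappa * r ^ 2))).
  { repeat apply Rmult_lt_0_compat; try apply exp_pos; try apply Rinv_0_lt_compat; nra. }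
  assert (kappa * r ^ 2 < 1) by nra.
  destruct (Rle_lt_dec 0 kappa);
    [rewrite Rabs_pos_eq by lra|rewrite Rabs_left by lra]; lra.
Qed.

Lemma enlargement_exists :
  -1 < kappa < 1 -> exists r, enlargement (sigma_k kappa) r.
Proof.
  intros Hk. assert (Ha : Rabs kappa < 1) by (apply Rabs_def1; lra).
  pose proof (Rabs_pos kappa) as Ha0.
  (* This choice gives [r^2 + |kappa| r^2 = 2], so that [r^2 > 1] and [|kappa| r^2 < 1] are the same
     condition, and it follows from [|kappa| < 1]. *)
  set (r := sqrt (2 / (1 + Rabs kappa))).
  assert (Hr2 : r ^ 2 = 2 / (1 + Rabs kappa)).
  { unfold r. rewrite pow2_sqrt; [reflexivity|].
    left. apply Rdiv_lt_0_compat; lra. }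
  assert (E : r ^ 2 * (1 + Rabs kappa) = 2) by (rewrite Hr2; field; lra).
  assert (Hr0 : 0 <= r) by apply sqrt_pos. clearbody r.
  assert (Hr1 : 1 < r ^ 2).
  { destruct (Rlt_le_dec 1 (r ^ 2)) as [|H1]; auto. exfalso.
    apply (Rmult_le_compat_r (1 + Rabs kappa)) in H1; lra. }
  assert (Hr : 1 < r) by nra.
  assert (Hkr : Rabs kappa * r ^ 2 < 1) by lra.
  exists r. split; [exact Hr|]. split; [|split].
  - destruct smooth_on_sigma_k as [HU HS]. eexists. split; [exact HU|].
    split; [|exact HS]. intros x Hx. split; [exact I|].
    apply conf_pos_r with r; auto.
  - apply non_trapping_k; auto. lra.
  - apply strictly_convex_boundary_k; auto. lra.
Qed.

End Enlargements.

(** * Injectivity on the influx boundary and the totally real immersion *)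

Section Embedding.

Variable kappa : R.

(** On the unit circle bundle, [fst beta / snd beta = - 2 i Im a / (1 + kappa |z|^2)]
    for [a = conj z mu]: this is the conserved angular momentum. *)
Lemma angular_momentum (z m z' m' : C) :
  Cmod m = 1 -> Cmod m' = 1 ->
  den kappa z m <> RtoC 0 -> den kappa z' m' <> RtoC 0 ->
  0 < 1 + kappa * Cmod z ^ 2 -> 0 < 1 + kappa * Cmod z' ^ 2 ->
  beta_k kappa (z, m) = beta_k kappa (z', m') ->
  (1 + kappa * Cmod z' ^ 2) * Im (Cconj z * m)%C
    = (1 + kappa * Cmod z ^ 2) * Im (Cconj z' * m')%C.
Proof.
  intros Hm Hm' Hd Hd' Hz Hz' E.
  assert (H : forall x v : C, Cmod v = 1 -> den kappa x v <> RtoC 0 ->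
    (fst (beta_k kappa (x, v)) * conf kappa x
     = (Cconj (Cconj x * v) - Cconj x * v) * snd (beta_k kappa (x, v)))%C).
  { intros x v Hv Hx. rewrite beta_k_eq. cbn [fst snd].
    rewrite Cmult_conj, Cconj_conj. pose proof (unit_mult_conj v Hv) as Hu.
    transitivity ((x * (v * Cconj v) - v * v * Cconj x) * conf kappa x
                  / den kappa x v)%C.
    - rewrite Hu. field. exact Hx.
    - field. exact Hx. }
  pose proof (H z m Hm Hd) as H1. pose proof (H z' m' Hm' Hd') as H2.
  rewrite <- E in H2.
  assert (Hxi : snd (beta_k kappa (z, m)) <> RtoC 0).
  { rewrite beta_k_eq. cbn [fst snd].
    assert (m <> RtoC 0) by (intros ->; rewrite Cmod_0 in Hm; lra).
    apply Cmult_neq_0; auto. apply Cmult_neq_0; [now apply conf_neq_0|].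
    intros E0. apply C1_nz. rewrite <- (Cinv_r _ Hd), E0. ring. }
  set (w := fst (beta_k kappa (z, m))) in *.
  set (xi := snd (beta_k kappa (z, m))) in *.
  set (a := (Cconj z * m)%C) in *. set (a' := (Cconj z' * m')%C) in *.
  assert (H3 : (conf kappa z' * (Cconj a - a))%C = (conf kappa z * (Cconj a' - a'))%C).
  { transitivity (conf kappa z' * (Cconj a - a) * xi / xi)%C; [field; auto|].
    transitivity (conf kappa z * (Cconj a' - a') * xi / xi)%C; [|field; auto].
    f_equal. rewrite <- !Cmult_assoc, <- H1, <- H2. ring. }
  rewrite <- !conf_RtoC in H3. apply (f_equal Im) in H3.
  rewrite !im_scal_l in H3. simpl in H3. simpl. unfold Im. lra.
Qed.

Lemma influx_boundary_k (p : CC) :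
  influx_boundary (sigma_k kappa) p ->
  Cmod (fst p) = 1 /\ Cmod (snd p) = 1 /\ Re (Cconj (fst p) * snd p)%C <= 0.
Proof.
  destruct p as [z m]. intros (Hz & Hm & Hin). split; [exact Hz|].
  split; [now apply unit_vector_chart in Hm|].
  cbn [fst snd] in *. change C in z, m.
  rewrite metric_normal in Hin. unfold chart in Hin. cbn [fst snd] in Hin.
  rewrite <- Cmult_assoc, re_scal_l in Hin.
  pose proof (exp_pos (2 * sigma_k kappa z)).
  pose proof (exp_pos (- sigma_k kappa z)) as He.
  rewrite (Cmult_comm (Cconj _)).
  set (A := exp (2 * _)) in *. set (B := exp (- _)) in *.
  assert (HAB : 0 < A * (B / 1) * B) by (unfold Rdiv; repeat apply Rmult_lt_0_compat; lra).
  apply Rnot_lt_le. intros Hx. pose proof (Rmult_lt_0_compat _ _ HAB Hx). lra.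
Qed.

Hypothesis hkappa : -1 < kappa < 1.

(** On the unit circle the conserved angular momentum determines [Im a] for [a = conj z mu]. As
    [|a| = 1] and [Re a <= 0] for inward vectors, it determines [a], hence [den]. The second
    component of [beta] then gives [mu], and [z = conj a mu]. *)
Lemma beta_injective_influx (p p' : CC) :
  influx_boundary (sigma_k kappa) p -> influx_boundary (sigma_k kappa) p' ->
  beta_k kappa p = beta_k kappa p' -> p = p'.
Proof.
  intros Hp Hp' E. apply influx_boundary_k in Hp, Hp'.
  destruct p as [z m], p' as [z' m']. cbn [fst snd] in *.
  change C in z, m, z', m'.
  destruct Hp as (Hz & Hm & Ha), Hp' as (Hz' & Hm' & Ha').
  assert (Hd : den kappa z m <> RtoC 0)
    by (apply (den_neq_0_Z kappa hkappa (z, m)); split; cbn [fst snd]; lra).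
  assert (Hd' : den kappa z' m' <> RtoC 0)
    by (apply (den_neq_0_Z kappa hkappa (z', m')); split; cbn [fst snd]; lra).
  assert (Hq : 0 < 1 + kappa * Cmod z ^ 2) by (apply conf_pos; lra).
  assert (Hq' : 0 < 1 + kappa * Cmod z' ^ 2) by (apply conf_pos; lra).
  pose proof (angular_momentum z m z' m' Hm Hm' Hd Hd' Hq Hq' E) as HI.
  rewrite Hz, Hz' in HI. rewrite Hz in Hq.
  apply Rmult_eq_reg_l in HI; [|lra].
  set (a := (Cconj z * m)%C) in *. set (a' := (Cconj z' * m')%C) in *.
  assert (Hn : Cmod a = 1) by (unfold a; rewrite Cmod_conj_mult, Hz, Hm; ring).
  assert (Hn' : Cmod a' = 1) by (unfold a'; rewrite Cmod_conj_mult, Hz', Hm'; ring).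
  assert (Eaa : a = a').
  { pose proof (Cmod2_alt a) as N. pose proof (Cmod2_alt a') as N'.
    rewrite Hn in N. rewrite Hn' in N'. rewrite HI in N.
    apply injective_projections; [|exact HI].
    change (Re a = Re a'). nra. }
  assert (Eden : forall x v : C, den kappa x v
    = (1 + RtoC kappa * ((Cconj x * v) * (Cconj x * v)))%C)
    by (intros; unfold den; ring).
  assert (Hdd : den kappa z m = den kappa z' m').
  { rewrite !Eden. fold a a'. now rewrite Eaa. }
  assert (Em : m = m').
  { apply (f_equal snd) in E. rewrite !beta_k_eq in E. cbn [fst snd] in E.
    rewrite <- Hdd in E. rewrite <- !conf_RtoC, Hz, Hz' in E.
    assert (Hc : RtoC (1 + kappa * 1 ^ 2) <> RtoC 0) by (apply RtoC_neq_0; lra).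
    transitivity (m * (RtoC (1 + kappa * 1 ^ 2) / den kappa z m)
      * (den kappa z m / RtoC (1 + kappa * 1 ^ 2)))%C; [field; auto|].
    rewrite E. field. auto. }
  f_equal; [|exact Em].
  assert (Hza : forall x v : C, Cmod v = 1 -> x = (Cconj (Cconj x * v) * v)%C).
  { intros x v Hv. rewrite Cmult_conj, Cconj_conj.
    transitivity (x * (v * Cconj v))%C; [|ring].
    rewrite unit_mult_conj by exact Hv. ring. }
  rewrite (Hza z m Hm), (Hza z' m' Hm'). fold a a'. now rewrite Eaa, Em.
Qed.

Lemma torus_tangent_multiple (q v : CC) :
  fst q <> RtoC 0 -> snd q <> RtoC 0 -> torus_tangent q v ->
  exists s t : R, v = ((Ci * RtoC s * fst q)%C, (Ci * RtoC t * snd q)%C).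
Proof.
  assert (H : forall z w : C, z <> RtoC 0 -> Re (w * Cconj z)%C = 0 ->
    exists s : R, w = (Ci * RtoC s * z)%C).
  { intros z w Hz Hw. apply C_neq_0_sqr in Hz.
    exists (Im (w * Cconj z)%C / (Re z ^ 2 + Im z ^ 2)).
    destruct z as [a b], w as [c d]. simpl in *.
    rewrite !Rmult_1_r in *. assert (E : c * a + d * b = 0) by lra.
    apply injective_projections; simpl; apply Rminus_diag_uniq.
    - transitivity ((c * a + d * b) * a / (a * a + b * b)); [field; exact Hz|].
      rewrite E. unfold Rdiv. ring.
    - transitivity ((c * a + d * b) * b / (a * a + b * b)); [field; exact Hz|].
      rewrite E. unfold Rdiv. ring. }
  intros Hz Hm [H1 H2].
  destruct (H _ _ Hz H1) as [s Es], (H _ _ Hm H2) as [t Et].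
  exists s, t. now rewrite <- Es, <- Et; destruct v.
Qed.

(** On vectors tangent to the torus, [e1] takes values in the real line [i mu R],
    and by transversality it determines the first component.  The relation
    [e1 v = i e1 v'] therefore makes the first components of [v] and [v'] vanish;
    then the same argument applies to [e2]. *)
Lemma differential_beta_torus (q v v' : CC) :
  Cmod (snd q) = 1 -> 0 < 1 + kappa * Cmod (fst q) ^ 2 ->
  den kappa (fst q) (snd q) <> RtoC 0 -> Re (Cconj (fst q) * snd q)%C <> 0 ->
  torus_tangent q v -> torus_tangent q v' ->
  Defs.differential (beta_k kappa) q v =
    ((Ci * fst (Defs.differential (beta_k kappa) q v'))%C,
     (Ci * snd (Defs.differential (beta_k kappa) q v'))%C) ->
  v = (RtoC 0, RtoC 0).
Proof.
  intros Hm Hq Hd Ha Hv Hv' E.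
  assert (Hm0 : snd q <> RtoC 0) by (intros H; rewrite H, Cmod_0 in Hm; lra).
  assert (Hz0 : fst q <> RtoC 0).
  { intros H. apply Ha. rewrite H, RtoC_conj, Cmult_0_l. reflexivity. }
  destruct (torus_tangent_multiple q v Hz0 Hm0 Hv) as (s & t & Ev).
  destruct (torus_tangent_multiple q v' Hz0 Hm0 Hv') as (s' & t' & Ev').
  unfold Defs.differential in E. cbn [fst snd] in E.
  destruct (dir_deriv_beta kappa q v Hd) as [D1 D2].
  destruct (dir_deriv_beta kappa q v' Hd) as [D1' D2'].
  rewrite D1, D2, D1', D2' in E.
  pose proof (f_equal fst E) as F1. pose proof (f_equal snd E) as F2.
  cbn [fst snd] in F1, F2. clear E D1 D2 D1' D2'.
  destruct (dbeta_inv kappa _ _ (fst v) (Cconj (fst v)) (snd v) Hd) as [G1 G2].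
  destruct (dbeta_inv kappa _ _ (fst v') (Cconj (fst v')) (snd v') Hd) as [G1' G2'].
  rewrite F1, F2 in G1, G2. clear F1 F2.
  set (z := fst q) in *. set (m := snd q) in *.
  assert (K1 : e1 m (fst v) (Cconj (fst v)) = (Ci * e1 m (fst v') (Cconj (fst v')))%C)
    by (rewrite G1, G1'; ring).
  assert (K2 : e2 kappa z m (fst v) (Cconj (fst v)) (snd v)
    = (Ci * e2 kappa z m (fst v') (Cconj (fst v')) (snd v'))%C)
    by (rewrite G2, G2'; ring).
  clear G1 G2 G1' G2'. rewrite Ev, Ev' in K1, K2. cbn [fst snd] in K1, K2.
  assert (L1 : forall x : R, e1 m (Ci * RtoC x * z)%C (Cconj (Ci * RtoC x * z)%C)
    = (Ci * m * RtoC (2 * x * Re (Cconj z * m)%C))%C).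
  { intros x. pose proof (unit_mult_conj m Hm) as Hu.
    unfold e1. rewrite RtoC_mult, re_alt, !Cmult_conj, Cconj_conj, RtoC_conj.
    replace (Cconj Ci) with (- Ci)%C by (apply injective_projections; simpl; ring).
    rewrite RtoC_mult.
    transitivity (Ci * RtoC x * (z * (m * Cconj m) + m * m * Cconj z))%C.
    - rewrite Hu. ring.
    - field. }
  rewrite !L1 in K1.
  assert (HCi : forall (x y : R) (c : C), c <> RtoC 0 ->
    (Ci * c * RtoC x = Ci * (Ci * c * RtoC y))%C -> x = 0 /\ y = 0).
  { intros x y c Hc H.
    assert (H' : RtoC x = (Ci * RtoC y)%C).
    { transitivity (Ci * c * RtoC x / (Ci * c))%C; [field; split; auto using Ci_nz|].
      rewrite H. field. split; auto using Ci_nz. }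
    pose proof (f_equal fst H') as H1. pose proof (f_equal snd H') as H2.
    simpl in H1, H2. lra. }
  apply HCi in K1; [|exact Hm0]. destruct K1 as [S1 S2].
  assert (Hs : s = 0) by (apply Rmult_integral in S1; destruct S1; lra).
  assert (Hs' : s' = 0) by (apply Rmult_integral in S2; destruct S2; lra).
  subst s s'. unfold e2 in K2.
  assert (Hk : (Ci * (conf kappa z * m) * RtoC t
    = Ci * (Ci * (conf kappa z * m) * RtoC t'))%C).
  { rewrite !Cmult_conj, !RtoC_conj in K2.
    match type of K2 with ?a = ?b => transitivity a; [ring|]; rewrite K2; ring end. }
  apply HCi in Hk; [|apply Cmult_neq_0; auto; now apply conf_neq_0].
  destruct Hk as [-> _]. rewrite Ev.
  apply injective_projections; cbn [fst snd];
    match goal with |- ?a = ?b => change (@eq C a b) end; ring.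
Qed.

Lemma differential_beta_0 (q : CC) :
  den kappa (fst q) (snd q) <> RtoC 0 ->
  Defs.differential (beta_k kappa) q (RtoC 0, RtoC 0) = (RtoC 0, RtoC 0).
Proof.
  intros Hd. unfold Defs.differential.
  rewrite (proj1 (dir_deriv_beta kappa q _ Hd)), (proj2 (dir_deriv_beta kappa q _ Hd)).
  cbn [fst snd]. rewrite RtoC_conj. unfold dbeta1, dbeta2, e1, e2, den in *.
  apply injective_projections; cbn [fst snd];
    match goal with |- ?a = ?b => change (@eq C a b) end; field; exact Hd.
Qed.

Lemma totally_real_embedding_in (r : R) :
  1 < r -> Rabs kappa * r ^ 2 < 1 ->
  totally_real_alpha_embedding_in (sigma_k kappa) r (beta_k kappa).
Proof.
  intros Hr Hk. split; [apply beta_injective_influx|].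
  assert (HF : forall p : CC, exists q : CC, influx_boundary (sigma_k kappa) p ->
    Fg (sigma_k kappa) r p q /\
    Cmod (fst q) = r /\ Cmod (snd q) = 1 /\ beta_k kappa q = beta_k kappa p).
  { intros p. destruct (classic (influx_boundary (sigma_k kappa) p)) as [Hp|Hp].
    - destruct (influx_boundary_k p Hp) as (Hz & Hm & _).
      destruct (exit_and_flow_back kappa r ltac:(lra) Hk (fst p) (snd p))
        as (T & q & H1 & H2 & H3 & H4 & H5); [lra|exact Hm|].
      exists q. intros _. rewrite <- surjective_pairing in H2, H5.
      split; [exists T|]; auto.
    - exists p. tauto. }
  (* [Fg] is a relation while a function is required; choice selects an end point, arbitrary off the
     influx boundary. *)
  pose (F := fun p => proj1_sig (constructive_indefinite_description _ (HF p))).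
  assert (HFp : forall p : CC, influx_boundary (sigma_k kappa) p ->
    Fg (sigma_k kappa) r p (F p) /\
    Cmod (fst (F p)) = r /\ Cmod (snd (F p)) = 1 /\
    beta_k kappa (F p) = beta_k kappa p).
  { intros p. exact (proj2_sig (constructive_indefinite_description _ (HF p))). }
  assert (Hden : forall p : CC, influx_boundary (sigma_k kappa) p ->
    den kappa (fst (F p)) (snd (F p)) <> RtoC 0).
  { intros p Hp. destruct (HFp p Hp) as (_ & Hz & Hm & _).
    apply den_neq_0. rewrite Hz, Hm, Rmult_1_r. exact Hk. }
  assert (Hq : 0 < 1 + kappa * r ^ 2).
  { pose proof (kr_bound kappa r Hk). lra. }
  assert (Htrans : forall p : CC, influx_boundary (sigma_k kappa) p ->
    Re (Cconj (fst (F p)) * snd (F p))%C <> 0).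
  { intros p Hp E. pose proof (Hden p Hp) as Hd.
    destruct (HFp p Hp) as (_ & Hz & Hm & Hb).
    destruct (influx_boundary_k p Hp) as (Hz1 & Hm1 & _).
    destruct (F p) as [z' m'], p as [z m]. cbn [fst snd] in *.
    change C in z, m, z', m'.
    assert (HI := angular_momentum z' m' z m Hm Hm1 Hd).
    rewrite Hz, Hz1 in HI.
    assert (Hd1 : den kappa z m <> RtoC 0).
    { apply den_neq_0. rewrite Hz1, Hm1.
      pose proof (Rabs_pos kappa). nra. }
    specialize (HI Hd1 Hq ltac:(lra) Hb).
    pose proof (Cmod2_alt (Cconj z' * m')%C) as N.
    rewrite E, Cmod_conj_mult, Hz, Hm in N.
    pose proof (Cmod2_alt (Cconj z * m)%C) as N1.
    rewrite Cmod_conj_mult, Hz1, Hm1 in N1.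
    set (A := Im (Cconj z' * m')%C) in *. set (B := Im (Cconj z * m)%C) in *.
    pose proof (pow2_ge_0 (Re (Cconj z * m)%C)).
    assert (HA : A ^ 2 = r ^ 2) by lra.
    assert (HB : B ^ 2 <= 1) by lra.
    (* A glancing vector on the larger circle has [|Im (conj z mu)| = r], against at most 1 on the
       unit circle; conservation compares the two. *)
    assert (E2 : (1 + kappa) ^ 2 * r ^ 2 <= (1 + kappa * r ^ 2) ^ 2).
    { rewrite <- HA at 1.
      replace ((1 + kappa) ^ 2 * A ^ 2) with (((1 + kappa * 1 ^ 2) * A) ^ 2) by ring.
      rewrite HI, Rpow_mult_distr.
      apply Rle_trans with ((1 + kappa * r ^ 2) ^ 2 * 1); [|lra].
      apply Rmult_le_compat_l; [apply pow2_ge_0|exact HB]. }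
    assert (E3 : (1 + kappa) * r <= 1 + kappa * r ^ 2) by nra.
    (* This contradicts [E3], since [1 + kappa r^2 - (1 + kappa) r = (1 - r) (1 - kappa r)] is
       negative. *)
    assert (E4 : kappa * r < 1).
    { pose proof (Rle_abs kappa). pose proof (Rabs_pos kappa). nra. }
    nra. }
  exists F, (den_domain kappa), (beta_k kappa).
  split; [intros p Hp; apply HFp, Hp|].
  split; [apply open_den_domain|].
  split; [exact Hden|].
  split; [apply smooth_on_beta|].
  split; [intros p Hp; apply HFp, Hp|].
  assert (Hz : forall p, influx_boundary (sigma_k kappa) p ->
    0 < 1 + kappa * Cmod (fst (F p)) ^ 2).
  { intros p Hp. destruct (HFp p Hp) as (_ & -> & _). exact Hq. }
  split.
  - intros p v Hp Hv E.
    (* Injectivity of the differential is the totally real condition with second vector 0. *)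
    apply (differential_beta_torus (F p) v (RtoC 0, RtoC 0)); auto.
    + now apply HFp.
    + split; cbn [fst snd]; rewrite Cmult_0_l; reflexivity.
    + rewrite E, differential_beta_0 by auto. cbn [fst snd].
      now rewrite Cmult_0_r.
  - intros p v v' Hp Hv Hv' E.
    rewrite (differential_beta_torus (F p) v v'); auto.
    + now apply differential_beta_0, Hden.
    + now apply HFp.
Qed.

End Embedding.

Theorem theorem1p2 (kappa : R) (hkappa : -1 < kappa < 1) :
  holomorphic_blow_down_structure (sigma_k kappa) (beta_k kappa).
Proof.
  split; [now apply smooth_near_beta|].
  split; [split; [now apply enlargement_exists|]|].
  - intros r Hr. apply enlargement_bound in Hr.
    now apply totally_real_embedding_in.
  - split; [now apply biholomorphic_beta|].
    exists ((1 - Rabs kappa) ^ 2 / 16). split.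
    + assert (Rabs kappa < 1) by (apply Rabs_def1; lra).
      apply Rdiv_lt_0_compat; [apply pow_lt|]; lra.
    + intros p Hp. apply pullback_lower_bound; auto. now apply Z_int_Z.
Qed.
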